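(* Let $\mathcal{H}$ be a complex Hilbert space and let $A, B \in \mathbb{B}(\mathcal{H})$ be commuting, selfadjoint, invertible operators such that $0 < A \le B \le \frac{1}{2} I$. Put $A' := I - A$ and $B' := I - B$. If $0 < \lambda \le \frac{1}{2}$, then $$ B' \,\nabla_\lambda\, A' - B' \,\sharp_\lambda\, A' \;\le\; A \,\nabla_\lambda\, B - A \,\sharp_\lambda\, B . $$
   Context: $\mathbb{B}(\mathcal{H})$ is the algebra of all bounded linear operators on the complex Hilbert space $\mathcal{H}$, and $I$ is the identity operator. A selfadjoint $A\in\mathbb{B}(\mathcal{H})$ is positive ($A \ge 0$) if $\langle Ax, x\rangle \ge 0$ for all $x\in\mathcal{H}$, and strictly positive ($A>0$) if $\langle Ax,x\rangle > 0$ for all nonzero $x \in \mathcal{H}$. For selfadjoint $A,B$, $A \le B$ means $B - A \ge 0$. For positive invertible $A, B$ and $0<\lambda<1$, the weighted arithmetic and geometric means are $$A \,\nabla_\lambda\, B := (1-\lambda) A + \lambda B, \qquad A \,\sharp_\lambda\, B := A^{\frac12}\left(A^{-\frac12} B A^{-\frac12}\right)^{\lambda} A^{\frac12},$$ with real powers taken by continuous functional calculus. (The operators $A' = I-A$ and $B' = I-B$ satisfy $A', B' \ge \frac12 I$, so they are positive and invertible.) *)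

(* Defs.v *)
From HB Require Import structures.
From mathcomp Require Import all_boot all_order all_algebra.
From mathcomp Require Import all_classical all_reals all_analysis.
From mathcomp Require Import complex.

Set Implicit Arguments.
Unset Strict Implicit.
Unset Printing Implicit Defensive.

Import Order.TTheory GRing.Theory Num.Theory Num.Def.
Import numFieldNormedType.Exports.

Local Open Scope classical_set_scope.
Local Open Scope ring_scope.
Local Open Scope complex_scope.

(* As in mathcomp's sesquilinear forms, the inner product is linear in its
   first argument and conjugate-linear in the second. *)
HB.mixin Record CompleteNormedModule_isHilbert (R : realType) H
    of CompleteNormedModule R[i] H := {
  inner : {dot H for conjC};
  sqr_normE : forall x : H, `|x| ^+ 2 = inner x x
}.

#[short(type="hilbertType")]
HB.structure Definition Hilbert (R : realType) :=
  {H of CompleteNormedModule R[i] H & CompleteNormedModule_isHilbert R H}.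

(* For a linear map, continuity is boundedness (linear_bounded_continuous). *)
Definition bounded_op (R : realType) (H : hilbertType R) : {pred (H -> H)} :=
  fun T => `[< linear T /\ continuous T >].

Record bop (R : realType) (H : hilbertType R) := Bop {
  bop_fun :> H -> H;
  _ : bop_fun \in @bounded_op R H
}.

HB.instance Definition _ (R : realType) (H : hilbertType R) :=
  [isSub for @bop_fun R H].
HB.instance Definition _ (R : realType) (H : hilbertType R) :=
  [Choice of bop H by <:].

Section bop_algebra.
Variables (R : realType) (H : hilbertType R).
Implicit Types S T : bop H.

Lemma bopP T : linear T /\ continuous T.
Proof. by case: T => f fP; exact/asboolP. Qed.

Fact bounded_op_submod : submod_closed (@bounded_op R H).
Proof.
split=> [|a S T].
  apply/asboolP; split=> [b x y|]; first by rewrite scaler0 addr0.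
  exact: cst_continuous.
move=> /asboolP[Sl Sc] /asboolP[Tl Tc]; apply/asboolP; split.
  move=> b x y; rewrite !fctE Sl Tl !scalerDr !scalerA (mulrC a b).
  by rewrite !addrA; congr (_ + _); rewrite -!addrA; congr (_ + _); rewrite addrC.
move=> x; apply: cvgD; last exact: Tc.
by apply: cvgZr; exact: Sc.
Qed.

HB.instance Definition _ :=
  GRing.isSubmodClosed.Build R[i] (H -> H) (@bounded_op R H) bounded_op_submod.
HB.instance Definition _ := [SubChoice_isSubLmodule of bop H by <:].

Fact bop_one_subproof : idfun \in @bounded_op R H.
Proof. by apply/asboolP; split=> // x; exact: cvg_id. Qed.

Fact bop_mul_subproof S T : S \o T \in @bounded_op R H.
Proof.
have [Sl Sc] := bopP S; have [Tl Tc] := bopP T; apply/asboolP; split.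
  by move=> a x y /=; rewrite Tl Sl.
by move=> x; apply: continuous_comp; [exact: Tc|exact: Sc].
Qed.

Definition bop_one : bop H := Bop bop_one_subproof.
Definition bop_mul S T : bop H := Bop (bop_mul_subproof S T).

Fact bop_mulA : associative bop_mul.
Proof. by move=> S T U; apply/val_inj. Qed.
Fact bop_mul1l : left_id bop_one bop_mul.
Proof. by move=> T; apply/val_inj. Qed.
Fact bop_mul1r : right_id bop_one bop_mul.
Proof. by move=> T; apply/val_inj. Qed.
Fact bop_mulDl : left_distributive bop_mul +%R.
Proof. by move=> S T U; apply/val_inj. Qed.
Fact bop_mulDr : right_distributive bop_mul +%R.
Proof.
move=> S T U; apply/val_inj/funext => x /=.
have [Sl _] := bopP S.
by have := Sl 1 (T x) (U x); rewrite !scale1r.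
Qed.

HB.instance Definition _ := GRing.Zmodule_isPzRing.Build (bop H)
  bop_mulA bop_mul1l bop_mul1r bop_mulDl bop_mulDr.

End bop_algebra.

Section bop_order.
Variables (R : realType) (H : hilbertType R).
Implicit Types S T : bop H.

Definition selfadjoint T := forall x y : H, inner (T x) y = inner x (T y).

(* For z : R[i], [0 <= z] and [0 < z] imply that z is real. *)
Definition op_ge0 T := selfadjoint T /\ forall x : H, 0 <= inner (T x) x.

Definition op_gt0 T :=
  selfadjoint T /\ forall x : H, x != 0 -> 0 < inner (T x) x.

Definition op_le S T := op_ge0 (T - S).

(* The library's unit rings are nontrivial, while H may be zero here. *)
Definition op_invertible T := exists S, S * T = 1 /\ T * S = 1.

End bop_order.

Section functional_calculus.
Variables (R : realType) (H : hilbertType R).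
Implicit Types (T : bop H) (p : {poly R[i]}) (f : R[i] -> R[i]).

Definition opnorm T : R := sup [set complex.Re `|T x| | x in [set x : H | `|x| <= 1]].

Definition spectrum T : set R[i] := [set z | ~ op_invertible (T - z *: (1 : bop H))].

Definition op_horner p T : bop H := \sum_(i < size p) p`_i *: T ^+ i.

(* The continuous functional calculus f(T) of a selfadjoint T is the extension
   by continuity of p |-> p(T) from polynomials to C(spectrum T): if
   polynomials p_n converge to f uniformly on the spectrum of T, then f(T) is
   the limit of the p_n(T) in operator norm. *)
Definition is_fcalc T f S :=
  exists p : nat -> {poly R[i]},
    (forall e : R, 0 < e ->
       \forall n \near \oo,
         forall z, spectrum T z -> `|(p n).[z] - f z| <= e%:C) /\
    opnorm (op_horner (p n) T - S) @[n --> \oo] --> (0 : R).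

Definition fcalc T f : bop H := xget 0 [set S | is_fcalc T f S].

(* For T positive and invertible the spectrum is a subset of ]0, +oo[, where
   this is t |-> t ^ r. *)
Definition op_powR T (r : R) : bop H :=
  fcalc T (fun z => (complex.Re z `^ r)%:C).

End functional_calculus.

Section means.
Variables (R : realType) (H : hilbertType R).
Implicit Types (A B : bop H) (l : R).

Definition arith_mean l A B : bop H := (1 - l)%:C *: A + l%:C *: B.

Definition geom_mean l A B : bop H :=
  let Ah := op_powR A 2^-1 in
  let Anh := op_powR A (- 2^-1) in
  Ah * op_powR (Anh * B * Anh) l * Ah.

End means.

(* Main.v *)
(* With [S = 1 - A - B >= 0] one has [B' = A + S] and [A' = B + S], so that the
   arithmetic means differ by [S] and the inequality reads
   [A #_l B + S <= (A + S) #_l (B + S)]. For commuting operators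
   [A #_l B = A T^l] with [T = A^-1 B]. For [M] large,
   [t^l = M^l (1 - (1 - t / M))^l] is a limit of the partial sums of the binomial
   series, whose coefficients are negative after the first one, so the
   inequality follows from Jensen's inequality for [u^k], applied to
   [u = 1 - t / M] at commuting positive operators.
   Powers are defined by polynomials converging uniformly on the spectrum, and
   any such sequence computes them because [|p(T)| <= sup |p(spectrum T)|]: for
   [mu = |p(T)|^2] the operator [mu - p(T)^* p(T)] is not bounded below, so a
   factor [T - z] of this polynomial in [T] is not invertible. *)
Require Import Defs.
From HB Require Import structures.
From mathcomp Require Import all_boot all_order all_algebra.
From mathcomp Require Import all_classical all_reals all_analysis.
From mathcomp Require Import complex.
From mathcomp Require Import ring lra.

Set Implicit Arguments.
Unset Strict Implicit.
Unset Printing Implicit Defensive.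

Import Order.TTheory GRing.Theory Num.Theory.
Import numFieldNormedType.Exports.
Local Open Scope classical_set_scope.
Local Open Scope ring_scope.
Local Open Scope complex_scope.

(** * Operators on a Hilbert space *)

Section real_structure.
Variables (R : realType) (H : hilbertType R).
Implicit Types (x y z : H) (t : R) (c : R[i]).

(** Norms take values in [R[i]], whose order is only partial; their real parts move all estimates
    into [R]. *)
Definition cabs c : R := complex.Re `|c|.

Definition nrm x : R := complex.Re `|x|.

(** A real symmetric bilinear form, which by [selfadjointP] and [op_ge0P] still detects
    selfadjointness and positivity. *)
Definition rip x y : R := complex.Re (inner x y).

Lemma normE x : `|x| = (nrm x)%:C.
Proof. by rewrite /nrm RRe_real. Qed.

Lemma nrm_ge0 x : 0 <= nrm x.
Proof. by rewrite -lecR -normE normr_ge0. Qed.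

Lemma nrm0 : nrm (0 : H) = 0.
Proof. by rewrite /nrm normr0. Qed.

Lemma nrmN x : nrm (- x) = nrm x.
Proof. by rewrite /nrm normrN. Qed.

Lemma nrmD x y : nrm (x + y) <= nrm x + nrm y.
Proof. by rewrite -lecR rmorphD /= -!normE ler_normD. Qed.

Lemma nrm_eq0 x : (nrm x == 0) = (x == 0).
Proof. by rewrite -(inj_eq (@complexI R)) -normE normr_eq0. Qed.

Lemma cabsE c : `|c| = (cabs c)%:C.
Proof. by rewrite /cabs RRe_real. Qed.

Lemma cabsR t : cabs t%:C = `|t|.
Proof. by rewrite /cabs normc_def /= expr0n addr0 sqrtr_sqr. Qed.

Lemma nrmZ c x : nrm (c *: x) = cabs c * nrm x.
Proof. by apply: (@complexI R); rewrite rmorphM /= -!normE -cabsE normrZ. Qed.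

Lemma ripC x y : rip x y = rip y x.
Proof.
rewrite /rip hermC /= mul1r; by case: (inner y x).
Qed.

Lemma ripDl x y z : rip (x + y) z = rip x z + rip y z.
Proof. by rewrite /rip linearDl raddfD. Qed.

Lemma ripDr x y z : rip x (y + z) = rip x y + rip x z.
Proof. by rewrite !(ripC x) ripDl. Qed.

Lemma ripZl t x y : rip (t%:C *: x) y = t * rip x y.
Proof.
rewrite /rip linearZl_LR /=; case: (inner x y) => a b /=.
by rewrite mul0r subr0.
Qed.

Lemma ripZr t x y : rip x (t%:C *: y) = t * rip x y.
Proof. by rewrite !(ripC x) ripZl. Qed.

Lemma ripNl x y : rip (- x) y = - rip x y.
Proof. by rewrite /rip linearNl raddfN. Qed.

Lemma ripBl x y z : rip (x - y) z = rip x z - rip y z.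
Proof. by rewrite ripDl ripNl. Qed.

Lemma ripBr x y z : rip x (y - z) = rip x y - rip x z.
Proof. by rewrite !(ripC x) ripBl. Qed.

Lemma rip0l x : rip 0 x = 0.
Proof. by rewrite /rip linear0l. Qed.

Lemma ripxx x : rip x x = nrm x ^+ 2.
Proof.
apply: (@complexI R); rewrite rmorphXn /= -normE sqr_normE /rip.
by rewrite RRe_real // ger0_real.
Qed.

Lemma rip_le x y : rip x y <= nrm x * nrm y.
Proof.
have [->|y0] := eqVneq y 0.
  by rewrite nrm0 mulr0 ripC rip0l.
have ny : 0 < nrm y by rewrite lt_def nrm_eq0 y0 nrm_ge0.
have [->|x0] := eqVneq x 0.
  by rewrite nrm0 mul0r rip0l.
have nx : 0 < nrm x by rewrite lt_def nrm_eq0 x0 nrm_ge0.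
(* Cauchy-Schwarz: this square expands to [2 |x| |y| (|x| |y| - rip x y)]. *)
have : 0 <= nrm ((nrm y)%:C *: x - (nrm x)%:C *: y) ^+ 2 by exact: sqr_ge0.
rewrite -ripxx !ripBl !ripBr !(ripZl,ripZr) !ripxx (ripC y x) => h.
have h2 : 0 <= (nrm x * nrm y) * (nrm x * nrm y - rip x y) by lra.
by move: h2; rewrite pmulr_rge0 ?mulr_gt0 // subr_ge0.
Qed.

End real_structure.

(** * The operator algebra and its norm *)

Section operators.
Variables (R : realType) (H : hilbertType R).
Implicit Types (S T : bop H) (x y : H) (t : R) (c : R[i]).

HB.instance Definition _ T :=
  GRing.isLinear.Build R[i] H H *:%R (bop_fun T) (bopP T).1.

Lemma bopDE S T x : (S + T) x = S x + T x. Proof. by []. Qed.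
Lemma bopNE T x : (- T) x = - T x. Proof. by []. Qed.
Lemma bopZE c T x : (c *: T) x = c *: T x. Proof. by []. Qed.
Lemma bopME S T x : (S * T) x = S (T x). Proof. by []. Qed.
Lemma bop1E x : (1 : bop H) x = x. Proof. by []. Qed.
Lemma bop0E x : (0 : bop H) x = 0. Proof. by []. Qed.
Definition bopE := (bopDE, bopNE, bopZE, bopME, bop1E, bop0E).

Lemma bop_ext S T : (forall x, S x = T x) -> S = T.
Proof. by move=> ST; apply/val_inj/funext. Qed.

Lemma bop_scalerAl c S T : c *: (S * T) = (c *: S) * T.
Proof. by apply: bop_ext => x; rewrite !bopE. Qed.

Lemma bop_scalerAr c S T : c *: (S * T) = S * (c *: T).
Proof. by apply: bop_ext => x; rewrite !bopE linearZ. Qed.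

Lemma bop_bounded T : exists2 C, 0 <= C & forall x, nrm (T x) <= C * nrm x.
Proof.
have [_ Tc] := bopP T.
have /linear_bounded_continuous/linear_boundedP : continuous (T : H -> H) by [].
move=> /pinfty_ex_gt0[r r0 Tr]; exists (complex.Re r).
  by move: r0; rewrite ltcE => /andP[_ /ltW].
move=> x; rewrite -lecR rmorphM /= -!normE RRe_real ?Tr //.
exact: gtr0_real.
Qed.

Lemma opnormE T : opnorm T = sup [set nrm (T x) | x in [set x : H | nrm x <= 1]].
Proof.
congr sup; apply/seteqP; split=> _ [x /= x1 <-]; exists x => //=.
  by rewrite -lecR -normE.
by rewrite normE lecR.
Qed.

Lemma opnorm_has_sup T :
  has_sup [set nrm (T x) | x in [set x : H | nrm x <= 1]]%classic.
Proof.
split; first by exists (nrm (T 0)), 0 => //=; rewrite nrm0 ler01.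
have [C C0 TC] := bop_bounded T; exists C => _ [x /= x1 <-].
by rewrite (le_trans (TC x)) // ler_piMr.
Qed.

Lemma opnorm_ge0 T : 0 <= opnorm T.
Proof.
rewrite opnormE; apply: (sup_upper_bound (opnorm_has_sup T)).
by exists 0; rewrite ?linear0 /= ?nrm0.
Qed.

Lemma opnormP T x : nrm (T x) <= opnorm T * nrm x.
Proof.
have [->|x0] := eqVneq x 0; first by rewrite linear0 nrm0 mulr0.
have nx : 0 < nrm x by rewrite lt_def nrm_eq0 x0 nrm_ge0.
rewrite -ler_pdivrMr // opnormE; apply: (sup_upper_bound (opnorm_has_sup T)).
have nxi : cabs ((nrm x)^-1)%:C = (nrm x)^-1.
  by rewrite cabsR ger0_norm // invr_ge0 ltW.
exists (((nrm x)^-1)%:C *: x) => /=; first by rewrite nrmZ nxi mulVf // gt_eqF.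
by rewrite linearZ /= nrmZ nxi mulrC.
Qed.

Lemma opnorm_le T C : 0 <= C -> (forall x, nrm (T x) <= C * nrm x) -> opnorm T <= C.
Proof.
move=> C0 TC; rewrite opnormE; apply: ge_sup; first exact: (opnorm_has_sup T).1.
by move=> _ [x /= x1 <-]; rewrite (le_trans (TC x)) // ler_piMr.
Qed.

Lemma opnormD S T : opnorm (S + T) <= opnorm S + opnorm T.
Proof.
apply: opnorm_le => [|x]; first by rewrite addr_ge0 ?opnorm_ge0.
by rewrite bopE mulrDl (le_trans (nrmD _ _)) // lerD ?opnormP.
Qed.

Lemma opnormN T : opnorm (- T) = opnorm T.
Proof. by rewrite !opnormE; congr (sup (image _ _)); apply/funext => x; rewrite bopE nrmN. Qed.

Lemma opnormM S T : opnorm (S * T) <= opnorm S * opnorm T.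
Proof.
apply: opnorm_le => [|x]; first by rewrite mulr_ge0 ?opnorm_ge0.
by rewrite bopE (le_trans (opnormP _ _)) // -mulrA ler_wpM2l ?opnorm_ge0 ?opnormP.
Qed.

Lemma opnorm0 : opnorm (0 : bop H) = 0.
Proof.
apply/le_anti; rewrite opnorm_ge0 andbT; apply: opnorm_le => // x.
by rewrite bopE nrm0 mul0r.
Qed.

Lemma opnorm_le0 T : opnorm T <= 0 -> T = 0.
Proof.
move=> T0; apply: bop_ext => x; apply/eqP; rewrite -nrm_eq0 eq_le nrm_ge0 andbT.
by rewrite (le_trans (opnormP T x)) // mulr_le0_ge0 ?nrm_ge0.
Qed.

End operators.

(** * Convergence in operator norm *)

Section convergence.
Variables (R : realType) (H : hilbertType R).
Implicit Types (S T Y Z : bop H) (X : nat -> bop H) (x y : H) (t : R) (c : R[i]).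

Definition opcvg X Y := opnorm (X n - Y) @[n --> \oo] --> (0 : R).

Lemma opcvg_dom X Y (u : nat -> R) :
  (forall n, opnorm (X n - Y) <= u n) -> u n @[n --> \oo] --> (0 : R) ->
  opcvg X Y.
Proof.
move=> Xu u0; apply: (@squeeze_cvgr _ _ _ _ (cst 0) u) => //; last exact: cvg_cst.
by apply: nearW => n; rewrite opnorm_ge0 Xu.
Qed.

Lemma opcvg_cst Y : opcvg (fun=> Y) Y.
Proof. by apply: cvg_near_cst; apply: nearW => n; rewrite subrr opnorm0. Qed.

Lemma opcvgD X X' Y Y' :
  opcvg X Y -> opcvg X' Y' -> opcvg (fun n => X n + X' n) (Y + Y').
Proof.
move=> h h'; apply: (opcvg_dom (u := fun n => opnorm (X n - Y) + opnorm (X' n - Y'))).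
  by move=> n; rewrite opprD addrACA opnormD.
by rewrite -[0]addr0; exact: cvgD.
Qed.

Lemma opcvgN X Y : opcvg X Y -> opcvg (fun n => - X n) (- Y).
Proof.
by move=> h; apply: (opcvg_dom _ h) => n; rewrite -opprD opnormN.
Qed.

Lemma opcvgB X X' Y Y' :
  opcvg X Y -> opcvg X' Y' -> opcvg (fun n => X n - X' n) (Y - Y').
Proof. by move=> h /opcvgN; exact: opcvgD. Qed.

Lemma opcvgM X X' Y Y' :
  opcvg X Y -> opcvg X' Y' -> opcvg (fun n => X n * X' n) (Y * Y').
Proof.
move=> h h'.
apply: (opcvg_dom (u := fun n => opnorm (X n - Y) * opnorm (X' n - Y') +
   opnorm (X n - Y) * opnorm Y' + opnorm Y * opnorm (X' n - Y'))).
  move=> n; have -> : X n * X' n - Y * Y' =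
      (X n - Y) * (X' n - Y') + (X n - Y) * Y' + Y * (X' n - Y').
    by rewrite -mulrDr subrK mulrBl mulrBr addrA subrK.
  rewrite (le_trans (opnormD _ _)) // lerD ?opnormM //.
  by rewrite (le_trans (opnormD _ _)) // lerD ?opnormM.
have -> : (0 : R) = 0 * 0 + 0 * opnorm Y' + opnorm Y * 0.
  by rewrite !mulr0 mul0r !addr0.
apply: cvgD; last exact: cvgMl_tmp.
by apply: cvgD; [exact: cvgM|exact: cvgMr_tmp].
Qed.

Lemma opcvg_uniq X Y Z : opcvg X Y -> opcvg X Z -> Y = Z.
Proof.
move=> h h'; apply/eqP; rewrite -subr_eq0; apply/eqP/opnorm_le0.
have h2 : opnorm (Y - Z) @[n --> \oo] --> (0 : R).
  by have := opcvgB h h'; rewrite /opcvg; under eq_fun do rewrite subrr sub0r opnormN.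
by rewrite (cvg_unique (@norm_hausdorff _ _) (cvg_cst (opnorm (Y - Z))) h2).
Qed.

Lemma opcvg_comm X Y Z :
  (forall n, Z * X n = X n * Z) -> opcvg X Y -> Z * Y = Y * Z.
Proof.
move=> ZX XY; apply: (opcvg_uniq (opcvgM (opcvg_cst Z) XY)).
under [X in opcvg X]eq_fun do rewrite ZX.
exact: opcvgM XY (opcvg_cst Z).
Qed.

Lemma norm_rip_le x y t : nrm x <= t -> `|rip x y| <= t * nrm y.
Proof.
move=> xt; rewrite ler_norml lerNl -ripNl.
rewrite !(le_trans (rip_le _ _)) // ?nrmN ler_wpM2r ?nrm_ge0 //.
Qed.

Lemma rip_cvg X Y x y : opcvg X Y -> rip (X n x) y @[n --> \oo] --> rip (Y x) y.
Proof.
move=> h; apply: (@cvg_sub0 _ _ _ _ _ _ (cst (rip (Y x) y))); last exact: cvg_cst.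
apply/norm_cvg0P.
have h' : opnorm (X n - Y) * nrm x * nrm y @[n --> \oo] --> (0 : R).
  have -> : (0 : R) = 0 * nrm x * nrm y by rewrite !mul0r.
  by apply: cvgMr_tmp; exact: cvgMr_tmp.
apply: (@squeeze_cvgr _ _ _ _ (cst 0) _ _ _ _ _ h'); last exact: cvg_cst.
apply: nearW => n; rewrite /= normr_ge0 /= !fctE -ripBl norm_rip_le //.
exact: (opnormP (X n - Y) x).
Qed.

(** Replacing [y] by ['i *: y] turns the imaginary part of the inner product, up to sign, into a
    real part, so the real parts determine it. *)
Lemma selfadjointP T : selfadjoint T <-> forall x y, rip (T x) y = rip x (T y).
Proof.
split=> [sT x y|sT x y]; first by rewrite /rip sT.
have := sT x y; have := sT x ('i *: y).
have -> : T ('i *: y) = 'i *: T y by rewrite linearZ.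
rewrite /rip !linearZr_LR /=.
case: (inner (T x) y) (inner x (T y)) => a b [c d] /=.
rewrite !(mul0r, mul1r, opprK, oppr0, sub0r, add0r, mulN1r, opprK) => h1 h2.
congr (_ +i* _) => //; lra.
Qed.

(** For selfadjoint [T] the number [inner (T x) x] is its own conjugate, hence real. *)
Lemma op_ge0P T : op_ge0 T <-> selfadjoint T /\ forall x, 0 <= rip (T x) x.
Proof.
split=> -[sT T0]; split=> // x.
  by have := T0 x; rewrite lecE => /andP[].
rewrite lecE T0 andbT /=.
have : inner (T x) x = (inner (T x) x)^*%C by rewrite {1}sT hermC /= mul1r.
by case: (inner _ _) => a b [] h; apply/eqP; rewrite /=; lra.
Qed.

Lemma opcvg_selfadjoint X Y :
  (forall n, selfadjoint (X n)) -> opcvg X Y -> selfadjoint Y.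
Proof.
move=> sX h; apply/selfadjointP => x y.
have h1 := @rip_cvg X Y x y h; rewrite [RHS]ripC; have := @rip_cvg X Y y x h.
under eq_fun do rewrite ripC -(selfadjointP (X _)).1 //.
by move=> h2; rewrite (cvg_unique (@norm_hausdorff _ _) h1 h2).
Qed.

Lemma opcvg_ge0 X Y : (forall n, op_ge0 (X n)) -> opcvg X Y -> op_ge0 Y.
Proof.
move=> X0 h; apply/op_ge0P; split.
  by apply: opcvg_selfadjoint h => n; exact: (X0 n).1.
move=> x; have h1 := @rip_cvg X Y x x h.
rewrite -(cvg_lim (@norm_hausdorff _ _) h1); apply: limr_ge.
  by apply/cvg_ex; eexists; exact: h1.
apply: nearW => n; by have /op_ge0P[_] := X0 n.
Qed.

Lemma bounded_op_of_bound (f : H -> H) C :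
  linear f -> (forall x, nrm (f x) <= C * nrm x) -> f \in @bounded_op R H.
Proof.
move=> fl fC; apply/asboolP; split=> //.
pose F : {linear H -> H} := HB.pack f (GRing.isLinear.Build R[i] H H *:%R f fl).
apply: (@bounded_linear_continuous _ _ _ F); apply/linear_boundedP.
exists C%:C; split; first by apply/complex_realP; exists C.
move=> c; rewrite ltcE => /andP[/eqP ic Cc] x.
rewrite !normE; move: c ic Cc => [a b] /= -> Cc.
rewrite -[a +i* 0]/(a%:C) -rmorphM lecR (le_trans (fC x)) //.
by rewrite ler_wpM2r ?nrm_ge0 // ltW.
Qed.

Lemma cvg_nrmP (u : nat -> H) y : u n @[n --> \oo] --> y <->
  forall e : R, 0 < e -> \forall n \near \oo, nrm (u n - y) <= e.
Proof.
split=> [/cvgrPdist_le h e e0|h].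
  have /h : 0 < e%:C :> R[i] by rewrite ltcR.
  by apply: filterS => n; rewrite normE lecR -nrmN opprB.
apply/cvgrPdist_le => -[a b]; rewrite ltcE /= => /andP[/eqP -> a0].
by have := h a a0; apply: filterS => n; rewrite -nrmN opprB normE lecR.
Qed.

(** Completeness of the operator algebra: pointwise limits exist because [H] is complete, and the
    Cauchy estimate passes to the limit uniformly on the unit ball. *)
Lemma opcauchy_cvg X :
  (forall e : R, 0 < e -> exists N, forall n m, (N <= n)%N -> (N <= m)%N ->
     opnorm (X n - X m) <= e) ->
  exists Y, opcvg X Y.
Proof.
move=> XC.
have Xx x : cvg (X n x @[n --> \oo]).
  apply/cauchy_cvgP/cauchy_exP => -[a b]; rewrite ltcE /= => /andP[/eqP -> a0].
  (* The summand 1 keeps the divisor positive at [x = 0]. *)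
  have e0 : 0 < a / 2 / (1 + nrm x) by rewrite !divr_gt0 // ltr_pwDl ?nrm_ge0.
  have [N hN] := XC _ e0; exists (X N x).
  near=> n; rewrite -ball_normE /=.
  have : nrm (X N x - X n x) <= a / 2.
    rewrite (le_trans (opnormP (X N - X n) x)) //.
    rewrite (le_trans (ler_wpM2r (nrm_ge0 _) (hN N n _ _))) //; first by near: n; exists N.
    rewrite mulrAC ler_pdivrMr ?ltr_pwDl ?nrm_ge0 // ler_wpM2l ?lerDr //.
    by rewrite divr_ge0 // ltW.
  move=> h; rewrite normE -[a +i* 0]/(a%:C) ltcR (le_lt_trans h) //; lra.
pose f x := lim (X n x @[n --> \oo]).
have fX x : X n x @[n --> \oo] --> f x by exact: Xx.
have fl : linear f.
  move=> c x y; apply: (cvg_lim (@norm_hausdorff _ _)).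
  under eq_fun do rewrite linearP.
  by apply: cvgD; last exact: fX; apply: cvgZl_tmp; exact: fX.
have fB e : 0 < e -> exists N, forall n x, (N <= n)%N -> nrm (X n x - f x) <= e * nrm x.
  move=> /XC[N hN]; exists N => n x Nn; apply/ler_addgt0Pr => d d0.
  have /cvg_nrmP/(_ d d0)[M _ hM] := fX x.
  (* The intermediate index [m] depends on [x] and [d], but neither [N] nor the final bound does. *)
  pose m := maxn N M.
  have -> : X n x - f x = (X n - X m) x + (X m x - f x) by rewrite !bopE addrA subrK.
  rewrite (le_trans (nrmD _ _)) // lerD //; last by apply: hM; rewrite /= leq_maxr.
  by rewrite (le_trans (opnormP _ _)) // ler_wpM2r ?nrm_ge0 // hN // leq_maxl.
have [N0 hN0] := fB 1 ltr01.
have fb : f \in @bounded_op R H.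
  apply: (@bounded_op_of_bound _ (opnorm (X N0) + 1)) => // x.
  rewrite -[f x](subKr (X N0 x)) (le_trans (nrmD _ _)) // mulrDl nrmN lerD ?opnormP //.
  exact: hN0.
exists (Bop fb); apply/cvgrPdist_le => e e0; have [N hN] := fB e e0.
near=> n; rewrite sub0r normrN ger0_norm ?opnorm_ge0 //.
apply: opnorm_le => [|x]; first exact: ltW.
by apply: hN; near: n; exists N.
Unshelve. all: by end_near. Qed.

End convergence.

(** * Positivity and location of the spectrum *)

Section numerical_bounds.
Variables (R : realType) (H : hilbertType R).
Implicit Types (S T L E Y Z : bop H) (x y : H) (t m M : R) (c z : R[i]).

Local Notation Id := (1 : bop H).

Lemma rip_opnorm T x : rip (T x) x <= opnorm T * nrm x ^+ 2.
Proof.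
rewrite (le_trans (rip_le _ _)) // expr2 mulrA ler_wpM2r ?nrm_ge0 //.
exact: opnormP.
Qed.

Lemma selfadjoint1 : selfadjoint (1 : bop H).
Proof. by []. Qed.

Lemma selfadjoint0 : selfadjoint (0 : bop H).
Proof. by apply/selfadjointP => x y; rewrite !bopE rip0l ripC rip0l. Qed.

Lemma selfadjointD S T : selfadjoint S -> selfadjoint T -> selfadjoint (S + T).
Proof.
move=> /selfadjointP sS /selfadjointP sT; apply/selfadjointP => x y.
by rewrite !bopE ripDl ripDr sS sT.
Qed.

Lemma selfadjointN T : selfadjoint T -> selfadjoint (- T).
Proof.
move=> /selfadjointP sT; apply/selfadjointP => x y.
by rewrite !bopE ripNl sT ripC -ripNl ripC.
Qed.

Lemma selfadjointB S T : selfadjoint S -> selfadjoint T -> selfadjoint (S - T).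
Proof. by move=> sS /selfadjointN; exact: selfadjointD. Qed.

Lemma selfadjointZ t T : selfadjoint T -> selfadjoint (t%:C *: T).
Proof.
move=> /selfadjointP sT; apply/selfadjointP => x y.
by rewrite !bopE ripZl ripZr sT.
Qed.

Lemma selfadjointM S T : selfadjoint S -> selfadjoint T -> S * T = T * S ->
  selfadjoint (S * T).
Proof.
move=> /selfadjointP sS /selfadjointP sT ST; apply/selfadjointP => x y.
by rewrite {2}ST !bopE sS sT.
Qed.

Lemma op_ge0D S T : op_ge0 S -> op_ge0 T -> op_ge0 (S + T).
Proof.
move=> /op_ge0P[sS S0] /op_ge0P[sT T0]; apply/op_ge0P; split.
  exact: selfadjointD.
by move=> x; rewrite bopE ripDl addr_ge0.
Qed.

Lemma op_ge0Z t T : 0 <= t -> op_ge0 T -> op_ge0 (t%:C *: T).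
Proof.
move=> t0 /op_ge0P[sT T0]; apply/op_ge0P; split; first exact: selfadjointZ.
by move=> x; rewrite bopE ripZl mulr_ge0.
Qed.

Lemma op_ge00 : op_ge0 (0 : bop H).
Proof.
apply/op_ge0P; split; first exact: selfadjoint0.
by move=> x; rewrite bopE rip0l.
Qed.

Lemma op_ge01 : op_ge0 (1 : bop H).
Proof.
apply/op_ge0P; split; first exact: selfadjoint1.
by move=> x; rewrite ripxx sqr_ge0.
Qed.

Lemma op_ge0_conj S T : selfadjoint S -> op_ge0 T -> op_ge0 (S * T * S).
Proof.
move=> /selfadjointP sS /op_ge0P[/selfadjointP sT T0]; apply/op_ge0P; split.
  by apply/selfadjointP => x y; rewrite !bopE sS sT sS.
by move=> x; rewrite !bopE sS.
Qed.

Lemma op_ge0_sqr S : selfadjoint S -> op_ge0 (S * S).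
Proof. by move=> sS; have := op_ge0_conj sS op_ge01; rewrite mulr1. Qed.

(* Positivity at [x - M^-1 L x]. *)
Lemma op_ge0_sqr_le L M x : op_ge0 L -> 0 < M ->
  (forall y, rip (L y) y <= M * nrm y ^+ 2) -> nrm (L x) ^+ 2 <= M * rip (L x) x.
Proof.
move=> /op_ge0P[/selfadjointP sL L0] M0 LM.
have := L0 (x - M^-1%:C *: L x).
rewrite linearB linearZ /= !ripBl !ripBr !(ripZl, ripZr) (sL (L x) x) ripxx.
have := LM (L x); set a := rip _ _; set b := _ ^+ 2; set d := rip _ _ => h1 h2.
have h3 : M^-1 * (M^-1 * a) <= M^-1 * b.
  by rewrite ler_pM2l ?invr_gt0 // ler_pdivrMl.
rewrite -ler_pdivrMl //; lra.
Qed.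

(** The form controls the norm of a positive operator: [|L x|^2 <= M <L x, x> <= M^2 |x|^2]. *)
Lemma op_ge0_opnorm L M : op_ge0 L -> 0 < M ->
  (forall y, rip (L y) y <= M * nrm y ^+ 2) -> opnorm L <= M.
Proof.
move=> L0 M0 LM; apply: opnorm_le => [|x]; first exact: ltW.
rewrite -ler_sqr ?nnegrE ?mulr_ge0 ?nrm_ge0 ?(ltW M0) //.
rewrite (le_trans (op_ge0_sqr_le x L0 M0 LM)) // exprMn [M ^+ 2]expr2 -mulrA.
by rewrite ler_pM2l.
Qed.

Lemma opnorm1 : opnorm (1 : bop H) <= 1.
Proof. by apply: opnorm_le => // x; rewrite bopE mul1r. Qed.

Lemma opnormX T t n : opnorm T <= t -> opnorm (T ^+ n) <= t ^+ n.
Proof.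
move=> Tt; elim: n => [|n IH]; first by rewrite !expr0 opnorm1.
rewrite !exprS (le_trans (opnormM _ _)) // ler_pM ?opnorm_ge0 //.
Qed.

(** The partial sums [G] of the Neumann series are Cauchy, and [(1 - E) * G n = 1 - E ^+ n] tends to
    1. *)
Lemma op_invertible_Neumann E t : opnorm E <= t -> t < 1 -> op_invertible (1 - E).
Proof.
move=> Et t1; have t0 : 0 <= t by rewrite (le_trans (opnorm_ge0 E)).
pose G n := \sum_(k < n) E ^+ k.
have GS n : G n.+1 = G n + E ^+ n by rewrite /G big_ord_recr.
have G1 n : (1 - E) * G n = 1 - E ^+ n.
  elim: n => [|n IH]; first by rewrite /G big_ord0 mulr0 expr0 subrr.
  by rewrite GS mulrDr IH mulrBl mul1r -exprS addrA subrK.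
have G2 n : G n * (1 - E) = 1 - E ^+ n.
  elim: n => [|n IH]; first by rewrite /G big_ord0 mul0r expr0 subrr.
  by rewrite GS mulrDl IH mulrBr mulr1 -exprSr addrA subrK.
have cE : t ^+ n @[n --> \oo] --> (0 : R) by apply: cvg_expr; rewrite ger0_norm.
have E0 : opcvg (fun n => E ^+ n) 0.
  by apply: (opcvg_dom _ cE) => n; rewrite subr0 opnormX.
have d0 : 0 < 1 - t by rewrite subr_gt0.
(* The right-hand side is the closed form of the geometric sum of [t ^+ j] over [n <= j < n + k]. *)
have GD n k : opnorm (G (n + k)%N - G n) <= (t ^+ n - t ^+ (n + k)) / (1 - t).
  elim: k => [|k IH]; first by rewrite addn0 !subrr opnorm0 mul0r.
  rewrite addnS GS addrAC (le_trans (opnormD _ _)) //.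
  rewrite (le_trans (lerD IH (opnormX _ Et))) // exprSr.
  rewrite ler_pdivlMr // mulrDl divfK ?gt_eqF //.
  by set a := t ^+ (n + k); set b := t ^+ n; lra.
have [Y GY] : exists Y, opcvg G Y.
  apply: opcauchy_cvg => e e0.
  have ed : 0 < e * (1 - t) by rewrite mulr_gt0.
  have /cvgrPdist_le/(_ _ ed)[N _ hN] := cE.
  have HN n k : (N <= n)%N -> opnorm (G (n + k)%N - G n) <= e.
    move=> Nn; rewrite (le_trans (GD n k)) // ler_pdivrMr //.
    have := hN n Nn; rewrite /= sub0r normrN ger0_norm ?exprn_ge0 //; apply: le_trans.
    by rewrite lerBlDr lerDl exprn_ge0.
  exists N => n m Nn Nm; case: (leqP n m) => nm.
    by rewrite -opprB opnormN -(subnKC nm) HN.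
  by rewrite -(subnKC (ltnW nm)) HN.
have h1 : opcvg (fun n => 1 - E ^+ n) 1.
  by have := opcvgB (opcvg_cst 1) E0; rewrite subr0.
exists Y; split.
- have := opcvgM GY (opcvg_cst (1 - E)).
  by under [X in opcvg X]eq_fun do rewrite G2; move=> /opcvg_uniq; exact.
- have := opcvgM (opcvg_cst (1 - E)) GY.
  by under [X in opcvg X]eq_fun do rewrite G1; move=> /opcvg_uniq; exact.
Qed.

Lemma op_invertibleZ c T : c != 0 -> op_invertible T -> op_invertible (c *: T).
Proof.
move=> c0 [S [ST TS]]; exists (c^-1 *: S).
by rewrite -!bop_scalerAl -!bop_scalerAr !scalerA ST TS mulVf // mulfV // scale1r.
Qed.

Lemma rip_shift T t x : rip ((T - t%:C *: Id) x) x = rip (T x) x - t * nrm x ^+ 2.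
Proof. by rewrite !bopE ripBl ripZl ripxx. Qed.

(** After scaling by a large [M], the operator [E = 1 - T / M] lies between 0 and [1 - m / M < 1],
    so the Neumann series applies. *)
Lemma op_invertible_ge T m : selfadjoint T -> 0 < m ->
  (forall x, m * nrm x ^+ 2 <= rip (T x) x) -> op_invertible T.
Proof.
move=> sT m0 Tm; pose M := opnorm T + m + 1.
(* [M] dominates [opnorm T], for [E >= 0], and is strictly larger than [m], for [1 - m / M > 0]. *)
have M0 : 0 < M by rewrite /M ltr_wpDl // addr_ge0 ?opnorm_ge0 // ltW.
pose E := 1 - M^-1%:C *: T.
have -> : T = M%:C *: (1 - E).
  by rewrite /E subKr scalerA -rmorphM mulfV ?gt_eqF // scale1r.
have mM : m / M < 1.
  by rewrite ltr_pdivrMr // mul1r /M; have := opnorm_ge0 T; lra.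
apply: op_invertibleZ; first by rewrite -[0]/(0%:C) (inj_eq (@complexI R)) gt_eqF.
have Ex x : rip (E x) x = nrm x ^+ 2 - M^-1 * rip (T x) x.
  by rewrite /E !bopE ripBl ripZl ripxx.
apply: (@op_invertible_Neumann _ (1 - m / M)); last first.
  by rewrite ltrBlDr ltrDl divr_gt0.
apply: op_ge0_opnorm; last 2 first.
- by rewrite subr_gt0.
- move=> x; rewrite Ex mulrBl mul1r lerD2l lerN2 mulrAC mulrC ler_pM2l ?invr_gt0 //.
apply/op_ge0P; split.
  by apply: selfadjointB; [exact: selfadjoint1|exact: selfadjointZ].
move=> x; rewrite Ex subr_ge0 ler_pdivrMl // (le_trans (rip_opnorm T x)) //.
by rewrite ler_wpM2r ?sqr_ge0 // /M; lra.
Qed.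

Lemma op_invertible_below T : op_invertible T ->
  exists2 c : R, 0 < c & forall x, c * nrm x <= nrm (T x).
Proof.
(* The norm of [S] vanishes when [H] is the zero space, hence the added 1. *)
move=> [S [ST _]]; have d0 : 0 < opnorm S + 1 by rewrite ltr_wpDl ?opnorm_ge0.
exists (opnorm S + 1)^-1 => [|x]; first by rewrite invr_gt0.
rewrite ler_pdivrMl // -{1}(bop1E x) -ST bopE (le_trans (opnormP _ _)) //.
by rewrite ler_wpM2r ?nrm_ge0 // lerDl.
Qed.

Lemma bop_mulDB T c : (T + c *: Id) * (T - c *: Id) = T * T - (c * c) *: Id.
Proof.
rewrite mulrDl !mulrBr -!bop_scalerAl -!bop_scalerAr !mul1r !mulr1 scalerA.
by rewrite addrA subrK.
Qed.

Lemma bop_mulBD T c : (T - c *: Id) * (T + c *: Id) = T * T - (c * c) *: Id.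
Proof. by have := bop_mulDB T (- c); rewrite !scaleNr opprK mulrNN. Qed.

(** For [z = a + ib] and [D = T - a], the product of [T - z] and [T - conj z] is [Q = D^2 + b^2]. If
    [z] is not a real number of [[m, M]], then [Q] is bounded below, hence invertible, and so is
    [T - z]. *)
Lemma spectrum_itv T m M z : selfadjoint T ->
  (forall x, m * nrm x ^+ 2 <= rip (T x) x) ->
  (forall x, rip (T x) x <= M * nrm x ^+ 2) ->
  spectrum T z -> exists2 t, z = t%:C & m <= t <= M.
Proof.
move=> sT Tm TM; case: z => a b zT.
have sD : selfadjoint (T - a%:C *: Id).
  by apply: selfadjointB => //; apply: selfadjointZ; exact: selfadjoint1.
suff /negP : ~~ ((b == 0) && (m <= a <= M)) -> False.
  by rewrite negbK => /andP[/eqP -> h]; exists a.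
move=> Nz; apply: zT.
pose z := a +i* b; pose D := T - a%:C *: Id; pose Q := D * D + (b ^+ 2)%:C *: Id.
have [d d0 Qd] : exists2 d, 0 < d & forall x, d * nrm x ^+ 2 <= rip (Q x) x.
  have Qx x : rip (Q x) x = nrm (D x) ^+ 2 + b ^+ 2 * nrm x ^+ 2.
    by rewrite /Q !bopDE bopME bopZE ripDl ripZl ripxx (selfadjointP D).1 // ripxx.
  have [b0|b0] := eqVneq b 0; last first.
    exists (b ^+ 2) => [|x]; last by rewrite Qx lerDr sqr_ge0.
    by rewrite lt_def sqrf_eq0 b0 sqr_ge0.
  (* For real [z] outside the interval the form of [D] stays away from 0, and Cauchy-Schwarz turns
     this into a lower bound for [|D x|]. *)
  have Dd d : 0 < d -> (forall x, d * nrm x ^+ 2 <= `|rip (D x) x|) ->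
     exists2 d, 0 < d & forall x, d * nrm x ^+ 2 <= rip (Q x) x.
    move=> d0 Dd; exists (d ^+ 2) => [|x]; first by rewrite exprn_gt0.
    rewrite Qx b0 expr0n mul0r addr0 -exprMn.
    rewrite ler_sqr ?nnegrE ?mulr_ge0 ?nrm_ge0 ?(ltW d0) //.
    have [->|x0] := eqVneq x 0; first by rewrite nrm0 mulr0 nrm_ge0.
    have nx : 0 < nrm x by rewrite lt_def nrm_eq0 x0 nrm_ge0.
    rewrite -(ler_pM2r nx) -mulrA -expr2 (le_trans (Dd x)) //.
    by rewrite norm_rip_le.
  move: Nz; rewrite b0 eqxx /= negb_and -!ltNge => /orP[am|Ma].
    apply: (Dd (m - a)) => [|x]; first by rewrite subr_gt0.
    rewrite (le_trans _ (ler_norm _)) // rip_shift mulrBl lerD2r //.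
  apply: (Dd (a - M)) => [|x]; first by rewrite subr_gt0.
  by rewrite -normrN (le_trans _ (ler_norm _)) // rip_shift opprB mulrBl lerD2l lerN2.
have sQ : selfadjoint Q.
  apply: selfadjointD; last by apply: selfadjointZ; exact: selfadjoint1.
  exact: selfadjointM.
have [V [VQ QV]] := op_invertible_ge sQ d0 Qd.
have zD : T - z *: Id = D - (b *i) *: Id.
  rewrite /D -addrA -opprD -scalerDl; congr (_ - _ *: _).
  by apply/eqP; rewrite eq_complex /= addr0 add0r !eqxx.
have bb : ((b *i) * (b *i) : R[i]) = - (b ^+ 2)%:C.
  by apply/eqP; rewrite eq_complex /= !mul0r !mulr0 sub0r addr0 oppr0 expr2 !eqxx.
have Q1 : (D + (b *i) *: Id) * (D - (b *i) *: Id) = Q.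
  by rewrite bop_mulDB bb scaleNr opprK.
have Q2 : (D - (b *i) *: Id) * (D + (b *i) *: Id) = Q.
  by rewrite bop_mulBD bb scaleNr opprK.
have VL : V * (D + (b *i) *: Id) * (T - z *: Id) = 1 by rewrite zD -mulrA Q1.
exists (V * (D + (b *i) *: Id)); split=> //.
(* The left inverse built from [V] must agree with the right inverse built from [V]. *)
have VR : (T - z *: Id) * ((D + (b *i) *: Id) * V) = 1 by rewrite zD mulrA Q2.
suff -> : V * (D + (b *i) *: Id) = (D + (b *i) *: Id) * V by [].
have inv_eq (U L W : bop H) : U * L = 1 -> L * W = 1 -> U = W.
  by move=> UL LW; rewrite -[U]mulr1 -LW mulrA UL mul1r.
exact: inv_eq VL VR.
Qed.

End numerical_bounds.

(** * Polynomials in an operator *)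

Section polynomials.
Variables (R : realType) (H : hilbertType R).
Implicit Types (S T P Z : bop H) (x y : H) (t e : R) (c z : R[i]) (p q : {poly R[i]}).

Local Notation Id := (1 : bop H).

Lemma op_horner_wide n p T : (size p <= n)%N ->
  op_horner p T = \sum_(i < n) p`_i *: T ^+ i.
Proof.
move=> pn; rewrite /op_horner (big_ord_widen _ (fun i => p`_i *: T ^+ i) pn).
rewrite big_mkcond; apply: eq_bigr => i _; case: ifPn => //.
by rewrite -leqNgt => /(nth_default 0) ->; rewrite scale0r.
Qed.

Lemma op_hornerD p q T : op_horner (p + q) T = op_horner p T + op_horner q T.
Proof.
pose n := maxn (size p) (size q).
rewrite !(@op_horner_wide n) ?leq_maxl ?leq_maxr ?size_polyD //.
by rewrite -big_split; apply: eq_bigr => i _; rewrite coefD scalerDl.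
Qed.

Lemma op_hornerZ c p T : op_horner (c *: p) T = c *: op_horner p T.
Proof.
rewrite !(@op_horner_wide (size p)) ?size_scale_leq // scaler_sumr.
by apply: eq_bigr => i _; rewrite coefZ scalerA.
Qed.

Lemma op_hornerN p T : op_horner (- p) T = - op_horner p T.
Proof. by rewrite -scaleN1r op_hornerZ scaleN1r. Qed.

Lemma op_hornerB p q T : op_horner (p - q) T = op_horner p T - op_horner q T.
Proof. by rewrite op_hornerD op_hornerN. Qed.

Lemma op_hornerC c T : op_horner c%:P T = c *: Id.
Proof.
rewrite (@op_horner_wide 1) ?size_polyC ?leq_b1 // big_ord1 coefC expr0.
by rewrite eqxx.
Qed.

Lemma op_hornerMX p T : op_horner (p * 'X) T = op_horner p T * T.
Proof.
rewrite (@op_horner_wide (size p).+1) ?(leq_trans (size_polyMleq _ _)) //; last first.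
  by rewrite size_polyX addn2.
rewrite big_ord_recl coefMX /= scale0r add0r /op_horner mulr_suml.
by apply: eq_bigr => i _; rewrite coefMX /= -bop_scalerAl -exprSr.
Qed.

Lemma op_hornerX T : op_horner 'X T = T.
Proof. by rewrite -['X]mul1r op_hornerMX -[1]/(1%:P) op_hornerC scale1r mul1r. Qed.

Lemma op_horner_comm p T Z : Z * T = T * Z -> Z * op_horner p T = op_horner p T * Z.
Proof.
move=> ZT; elim/poly_ind: p => [|p c IH].
  by rewrite -[0]/(0%:P) op_hornerC scale0r mulr0 mul0r.
rewrite op_hornerD op_hornerMX op_hornerC mulrDr mulrDl mulrA IH -!mulrA ZT.
by rewrite -bop_scalerAr -bop_scalerAl mulr1 mul1r.
Qed.

Lemma op_hornerM p q T : op_horner (p * q) T = op_horner p T * op_horner q T.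
Proof.
elim/poly_ind: p => [|p c IH].
  by rewrite mul0r -[0]/(0%:P) op_hornerC scale0r mul0r.
rewrite mulrDl -mulrA -commr_polyX mulrA op_hornerD op_hornerMX IH.
rewrite mul_polyC op_hornerZ op_hornerD op_hornerMX op_hornerC mulrDl.
by rewrite -!mulrA (op_horner_comm q (erefl (T * T))) -bop_scalerAl mul1r.
Qed.

Lemma op_hornerXn p n T : op_horner (p ^+ n) T = op_horner p T ^+ n.
Proof.
elim: n => [|n IH]; last by rewrite !exprS op_hornerM IH.
by rewrite !expr0 -[1]/(1%:P) op_hornerC scale1r.
Qed.

Lemma op_horner_sum (I : Type) (r : seq I) (F : I -> {poly R[i]}) T :
  op_horner (\sum_(i <- r) F i) T = \sum_(i <- r) op_horner (F i) T.
Proof.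
elim/big_ind2: _ => [|a p b q <- <-|//]; last by rewrite op_hornerD.
by rewrite -[0]/(0%:P) op_hornerC scale0r.
Qed.

Lemma op_horner_adj p T x y : selfadjoint T ->
  inner (op_horner p T x) y = inner x (op_horner (map_poly Num.conj p) T y).
Proof.
move=> sT; elim/poly_ind: p x y => [|p c IH] x y.
  by rewrite rmorph0 -[0]/(0%:P) op_hornerC scale0r !bop0E linear0l linear0r.
rewrite rmorphD rmorphM /= map_polyX map_polyC /= !op_hornerD !op_hornerMX.
rewrite !op_hornerC !bopDE !bopZE !bop1E linearDl linearDr linearZl_LR linearZr_LR /=.
congr (_ + _); last by rewrite conjCK.
by rewrite IH sT -2!bopME (op_horner_comm _ (erefl (T * T))).
Qed.

(** Over [R[i]] the polynomial splits into linear factors. Each [T - z] with [z] off the spectrum is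
    bounded below, and this property is stable under composition. *)
Lemma op_horner_below p T :
  p != 0 -> (forall z, spectrum T z -> ~~ root p z) ->
  exists2 c : R, 0 < c & forall x, c * nrm x <= nrm (op_horner p T x).
Proof.
move=> p0; have [r pr] := closed_field_poly_normal p.
have l0 : lead_coef p != 0 by rewrite lead_coef_eq0.
have cl0 : 0 < cabs (lead_coef p).
  by rewrite -ltcR -cabsE normr_gt0.
rewrite pr => pT; have {pT} : forall z, z \in r -> ~ spectrum T z.
  by move=> z zr /pT; rewrite rootZ // root_prod_XsubC zr.
(* Only the roots and a nonzero leading coefficient are kept for the induction. *)
elim: r {p p0 pr} (lead_coef p) cl0 {l0} => [|z r IH] l l0 rT.
  exists (cabs l) => // x.
  by rewrite big_nil op_hornerZ -[1]/(1%:P) op_hornerC scale1r bopZE nrmZ.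
have [|c c0 cr] := IH _ l0; first by move=> w wr; apply: rT; rewrite inE wr orbT.
have /contrapT/op_invertible_below[d d0 dT] := rT z (mem_head z r).
exists (c * d) => [|x]; first exact: mulr_gt0.
rewrite big_cons [X in _ *: X]mulrC scalerAl op_hornerM bopME -mulrA (le_trans _ (cr _)) //.
by rewrite ler_pM2l // op_hornerB op_hornerX op_hornerC dT.
Qed.

(** Here [S] is the adjoint of [P], and [L = N^2 - S P] is positive. A lower bound [c] for [L] would
    give [c^2 |x|^2 <= |L x|^2 <= N^2 <L x, x>], hence [|P x|^2 <= (N^2 - c^2 / N^2) |x|^2], against
    [N] being the norm. *)
Lemma opnorm_not_below P S : (forall x y, rip (P x) y = rip x (S y)) ->
  0 < opnorm P ->
  ~ exists2 c : R, 0 < c &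
      forall x, c * nrm x <= nrm (((opnorm P ^+ 2)%:C *: Id - S * P) x).
Proof.
set N := opnorm P => PS N0 [c c0]; set L := (_ - _) => Lc.
have N20 : 0 < N ^+ 2 by rewrite exprn_gt0.
have Lx x : rip (L x) x = N ^+ 2 * nrm x ^+ 2 - nrm (P x) ^+ 2.
  by rewrite /L !bopE ripBl ripZl ripxx (ripC _ x) -PS ripxx.
have L0 : op_ge0 L.
  apply/op_ge0P; split.
    apply: selfadjointB; first by apply: selfadjointZ; exact: selfadjoint1.
    by apply/selfadjointP => x y; rewrite !bopE -PS ripC -PS ripC.
  move=> x; rewrite Lx subr_ge0 -exprMn ler_sqr ?nnegrE ?mulr_ge0 ?nrm_ge0 ?(ltW N0) //.
  exact: opnormP.
pose mu := N ^+ 2 - c ^+ 2 / N ^+ 2.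
have muN : mu < N ^+ 2 by rewrite /mu ltrBlDr ltrDl divr_gt0 // exprn_gt0.
(* [mu] may be negative; [Num.sqrt] is then 0, and the inequality still holds. *)
have s_mu : mu <= Num.sqrt mu ^+ 2.
  have [mu0|mu0] := leP 0 mu; first by rewrite sqr_sqrtr.
  by rewrite (le_trans (ltW mu0)) // sqr_ge0.
have s_N : Num.sqrt mu < N.
  have [mu0|mu0] := leP 0 mu; last by rewrite ltr0_sqrtr.
  by rewrite -[N]ger0_norm ?(ltW N0) // -sqrtr_sqr ltr_sqrt.
suff : N <= Num.sqrt mu by rewrite leNgt s_N.
apply: opnorm_le => [|x]; first exact: sqrtr_ge0.
rewrite -ler_sqr ?nnegrE ?mulr_ge0 ?nrm_ge0 ?sqrtr_ge0 // exprMn.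
rewrite (le_trans _ (ler_wpM2r (sqr_ge0 _) s_mu)) //.
have : c ^+ 2 * nrm x ^+ 2 <= N ^+ 2 * rip (L x) x.
  rewrite -exprMn (le_trans _ (op_ge0_sqr_le x L0 N20 _)) //.
    by rewrite ler_sqr ?nnegrE ?mulr_ge0 ?nrm_ge0 ?(ltW c0).
  by move=> y; rewrite Lx lerBlDr lerDl sqr_ge0.
by rewrite Lx -ler_pdivrMl // /mu; lra.
Qed.

Lemma horner_conj_real p t : (map_poly Num.conj p).[t%:C] = Num.conj p.[t%:C].
Proof. by rewrite -[X in _.[X]](conjc_real t) -horner_map. Qed.

(** The polynomial [N^2 - conj p * p] evaluated at [T] is not bounded below, so it has a root [z] in
    the spectrum. Since [z] is real, its value there is [N^2 - |p(z)|^2]. *)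
Lemma op_horner_attained p T : selfadjoint T -> 0 < opnorm (op_horner p T) ->
  (opnorm (op_horner p T) ^+ 2)%:C%:P - map_poly Num.conj p * p != 0 ->
  exists2 z, spectrum T z & (opnorm (op_horner p T) ^+ 2)%:C = `|p.[z]| ^+ 2.
Proof.
set N := opnorm _ => sT N0 q0; apply: contrapT => Nz.
have /opnorm_not_below : forall x y, rip (op_horner p T x) y =
    rip x (op_horner (map_poly Num.conj p) T y).
  by move=> x y; rewrite /rip op_horner_adj.
move=> /(_ N0); apply; rewrite -/N -(op_hornerC _ T) -op_hornerM -op_hornerB.
apply: op_horner_below => // z zT; apply/negP => /rootP qz; apply: Nz; exists z => //.
have [|||t zt _] := @spectrum_itv _ _ T (- opnorm T) (opnorm T) z sT; rewrite ?zt //.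
- by move=> x; rewrite mulNr lerNl -ripNl -bopNE -opnormN rip_opnorm.
- exact: rip_opnorm.
move: qz; rewrite !hornerE => /eqP; rewrite subr_eq0 => /eqP ->.
by rewrite zt horner_conj_real mulrC -normCK.
Qed.

Lemma op_horner_spectrum_bound p T e : selfadjoint T -> 0 <= e ->
  (forall z, spectrum T z -> `|p.[z]| <= e%:C) -> opnorm (op_horner p T) <= e.
Proof.
move=> sT e0 pe; rewrite leNgt; apply/negP => eN.
set N := opnorm _ in eN; have N0 : 0 < N by exact: le_lt_trans eN.
have Np z : spectrum T z -> (N ^+ 2)%:C <> `|p.[z]| ^+ 2.
  move=> zT Nz; have : `|p.[z]| ^+ 2 <= e%:C ^+ 2.
    by apply: lerXn2r; rewrite ?nnegrE ?normr_ge0 ?ler0c ?pe.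
  by rewrite -Nz -rmorphXn lecR ler_sqr ?nnegrE ?(ltW N0) // leNgt eN.
(* If this polynomial is zero, then [|p|] equals [N] at every real point, and any point of the
   spectrum gives the contradiction. *)
have [q0|q0] := eqVneq ((N ^+ 2)%:C%:P - map_poly Num.conj p * p) 0; last first.
  have [z zT Nz] := op_horner_attained sT N0 q0.
  exact: Np zT Nz.
(* The norm of a nonzero [T] is attained on the spectrum, by the case [p = 'X]; for [T = 0] the
   point 0 works, as [N > 0] excludes the zero space. *)
have [z zT] : exists z, spectrum T z.
  have [T0|T0] := ltP 0 (opnorm T).
    have T0' : 0 < opnorm (op_horner 'X T) by rewrite op_hornerX.
    have [|z zT _] := op_horner_attained sT T0'; last by exists z.
    rewrite map_polyX subr_eq0; apply: contraTneq isT => /(congr1 (size \o val)) /=.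
    by rewrite size_polyC -expr2 size_polyXn; case: (_ != 0).
  exists 0 => -[V [_ V0]].
  have Id0 : Id = 0 by rewrite -V0 scale0r subr0 (opnorm_le0 T0) mul0r.
  by move: N0; rewrite /N -[op_horner _ _]mulr1 Id0 mulr0 opnorm0 ltxx.
apply: (Np z zT).
have [|||t zt _] := @spectrum_itv _ _ T (- opnorm T) (opnorm T) z sT; rewrite ?zt //.
- by move=> x; rewrite mulNr lerNl -ripNl -bopNE -opnormN rip_opnorm.
- exact: rip_opnorm.
have := congr1 (horner^~ z) q0; rewrite !hornerE => /eqP; rewrite subr_eq0 => /eqP ->.
by rewrite zt horner_conj_real mulrC -normCK.
Qed.

End polynomials.

(** * The binomial series *)

Section binomial_series.
Variable R : realType.
Implicit Types (r u t m M e : R) (n k : nat).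

(* The coefficients of the power series of [(1 - u) `^ r]. *)
Fixpoint binc r n : R :=
  if n is k.+1 then binc r k * ((k%:R - r) / k.+1%:R) else 1.

Definition binser r n u : R := \sum_(k < n) binc r k * u ^+ k.

(** The termwise derivative of [binser]; at [k = 0] the factor [k%:R] cancels the truncated
    power. *)
Definition dbinser r n u : R := \sum_(k < n) binc r k * (k%:R * u ^+ k.-1).

Lemma bincS r n : n.+1%:R * binc r n.+1 = (n%:R - r) * binc r n.
Proof.
by rewrite /= mulrCA [X in _ * X]mulrCA mulfV ?pnatr_eq0 // mulr1 mulrC.
Qed.

(** Each factor [(k - r) / (k + 1)] has absolute value at most 1. *)
Lemma binc_le1 r n : -1 <= r <= 1 -> `|binc r n| <= 1.
Proof.
move=> /andP[r1 r2]; elim: n => [|n IH] /=; first by rewrite normr1.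
rewrite normrM mulr_ile1 ?normr_ge0 // normrM normfV normr_nat.
rewrite ler_pdivrMr ?ltr0n // mul1r ler_norml -natr1.
by have : 0 <= n%:R :> R by []; move=> n0; apply/andP; split; lra.
Qed.

(** The first factor is [- r <= 0] and all later ones are nonnegative. This sign is what lets
    Jensen's inequality be summed over the series. *)
Lemma binc_le0 r n : 0 <= r <= 1 -> binc r n.+1 <= 0.
Proof.
move=> /andP[r0 r1]; elim: n => [|n IH]; first by rewrite /= mul1r divr1 sub0r oppr_le0.
rewrite -(@ler_pM2l _ n.+2%:R) ?ltr0n // mulr0 bincS mulr_ge0_le0 //.
by rewrite subr_ge0 -natr1 (le_trans r1) // lerDr.
Qed.

Lemma binser_derive r n u : is_derive u 1 (binser r n) (dbinser r n u).
Proof.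
elim: n => [|n IH].
  have -> : binser r 0 = cst 0 by apply/funext => x; rewrite /binser big_ord0.
  by rewrite /dbinser big_ord0; exact: is_derive_cst.
have -> : binser r n.+1 = binser r n + (binc r n \*: (id ^+ n)).
  apply/funext => x; rewrite /binser big_ord_recr /= !fctE; congr (_ + _ * _);
    by elim: n {IH} => [|n IHn]; rewrite ?exprS ?IHn.
have := @is_deriveX _ _ id n u 1 1 (is_derive_id _ _).
move=> /(@is_deriveZ _ _ _ _ (binc r n) _ _ _)/(is_deriveD IH) h; apply: (is_derive_eq h).
by rewrite /dbinser big_ord_recr /=; congr (_ + _ * _); rewrite /GRing.scale /= mulr1.
Qed.

Arguments binc : simpl never.

(* [binser r n] solves [(1 - u) g' + r g = 0] up to its last term. *)
Lemma dbinserE r n u :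
  (1 - u) * dbinser r n.+1 u + r * binser r n.+1 u =
  - (n.+1%:R * binc r n.+1 * u ^+ n).
Proof.
elim: n => [|n IH].
  rewrite bincS /dbinser /binser !big_ord_recr !big_ord0 /= !expr0 mulr0n /binc; ring.
rewrite /dbinser /binser big_ord_recr [in X in r * X]big_ord_recr /=.
rewrite -/(dbinser r n.+1 u) -/(binser r n.+1 u) !mulrDr addrACA IH [n.+2%:R * _]bincS exprS.
by set a := binc r n.+1; set b := u ^+ n; ring.
Qed.

Lemma binser_err r n u (d : R) : -1 <= r <= 1 -> 0 < d -> 0 <= u -> u <= 1 - d ->
  `|binser r n.+1 u - (1 - u) `^ r| <= d^-1 ^+ 3 * (n.+1%:R * (1 - d) ^+ n).
Proof.
move=> r1 d0 u0 ud; have /andP[rl rr] := r1.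
have u1 : 0 < 1 - u by lra.
pose h (v : R) : R := binser r n.+1 v * (1 - v) `^ (- r).
pose dh (v : R) : R := - (n.+1%:R * binc r n.+1 * v ^+ n) * (1 - v) `^ (- r - 1).
have hd (v : R) : v < 1 -> is_derive v 1 h (dh v).
  move=> v1; have v10 : 0 < 1 - v by lra.
  have hs : is_derive v 1 (fun w : R => 1 - w) (-1).
    have := is_deriveB (is_derive_cst (1 : R) v 1) (is_derive_id v (1 : R)).
    by rewrite sub0r.
  have := is_deriveM (binser_derive r n.+1 v)
     (@is_derive1_comp R (fun x : R => x `^ (- r)) (fun w => 1 - w) v _ _
        (is_derive1_powR (- r) v10) hs).
  move=> h'; apply: (is_derive_eq h'); rewrite /dh -dbinserE /GRing.scale /=.
  have -> : (1 - v) `^ (- r) = (1 - v) * (1 - v) `^ (- r - 1).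
    rewrite -[X in X * _]powRr1 ?(ltW v10) // -powRD ?(gt_eqF v10) ?implybT //.
    by congr (_ `^ _); ring.
  ring.
have hc : {within `[0, u], continuous h}.
  apply: derivable_within_continuous => v; rewrite in_itv /= => /andP[_ vu].
  by apply: (@ex_derive _ _ _ _ _ _ _ (hd v _)); lra.
have [|c] := @MVT_segment _ h dh 0 u u0 _ hc.
  by move=> v; rewrite in_itv /= => /andP[_ vu]; apply: hd; lra.
rewrite in_itv /= => /andP[c0 cu].
have -> : h 0 = 1.
  rewrite /h /binser big_ord_recl /= subr0 powR1 mulr1 expr0 mulr1.
  by rewrite big1 ?addr0 // => i _; rewrite exprS mul0r mulr0.
rewrite subr0 => hE.
have -> : binser r n.+1 u - (1 - u) `^ r = (1 - u) `^ r * (h u - 1).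
  rewrite /h mulrBr mulr1 mulrCA -powRD ?(gt_eqF u1) ?implybT // subrr powRr0.
  by rewrite mulr1.
have bd (v : R) : d <= v -> v <= 1 -> 0 < v <= 1 by move=> dv v1; apply/andP; split; lra.
(* Of the three factors [d^-1], one pays for [(1 - u)]^ r[and two for](1 - c) [^ (- r - 1)], whose
   exponents are at least -1 and -2. *)
have pb (v s : R) k : d <= v -> v <= 1 -> - k%:R <= s -> v `^ s <= d^-1 ^+ k.
  move=> dv v1 sk; rewrite (le_trans (ger_powR (bd v dv v1) sk)) //.
  have v0 : 0 < v by lra.
  rewrite powR_invn ?(ltW v0) // -exprVn lerXn2r ?nnegrE ?invr_ge0 ?(ltW v0) ?(ltW d0) //.
  by rewrite lef_pV2 ?posrE.
have := binc_le1 n.+1 r1; rewrite hE /dh; move: (binc r n.+1) => b h4.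
rewrite mulNr mulNr mulrN normrN !normrM.
rewrite !(ger0_norm (powR_ge0 _ _)) normrX (ger0_norm c0) (ger0_norm u0) normr_nat.
have h1 : (1 - u) `^ r <= d^-1 ^+ 1 by apply: pb; lra.
have h2 : (1 - c) `^ (- r - 1) <= d^-1 ^+ 2 by apply: pb; lra.
have h3 : c ^+ n <= (1 - d) ^+ n by rewrite lerXn2r ?nnegrE //; lra.
have u1' : u <= 1 by lra.
have -> : d^-1 ^+ 3 * (n.+1%:R * (1 - d) ^+ n) =
    d^-1 ^+ 1 * (n.+1%:R * 1 * (1 - d) ^+ n * d^-1 ^+ 2 * 1) by ring.
apply: ler_pM => //; rewrite ?mulr_ge0 ?powR_ge0 ?exprn_ge0 ?normr_ge0 //.
apply: ler_pM => //; rewrite ?mulr_ge0 ?powR_ge0 ?exprn_ge0 ?normr_ge0 //.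
apply: ler_pM => //; rewrite ?mulr_ge0 ?powR_ge0 ?exprn_ge0 ?normr_ge0 //.
apply: ler_pM => //; rewrite ?mulr_ge0 ?powR_ge0 ?exprn_ge0 ?normr_ge0 //.
by rewrite ler_wpM2l.
Qed.

(** With [q] the square root of [s], one factor [q ^+ n] absorbs [n.+1] and the other tends to 0. *)
Lemma cvg_nat_geometric (s : R) : 0 <= s -> s < 1 ->
  n.+1%:R * s ^+ n @[n --> \oo] --> (0 : R).
Proof.
move=> s0 s1; pose q := Num.sqrt s.
have q0 : 0 <= q by exact: sqrtr_ge0.
have qs : q ^+ 2 = s by rewrite sqr_sqrtr.
have q1 : q < 1 by rewrite -sqrtr1 ltr_sqrt.
have qn n : n%:R * q ^+ n * (1 - q) <= 1 - q ^+ n.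
  elim: n => [|n IH]; first by rewrite !mul0r expr0 subrr.
  rewrite exprS -natr1 mulrDl mul1r mulrDl mulrCA -mulrA.
  have h : q * (n%:R * q ^+ n * (1 - q)) <= q * (1 - q ^+ n) by rewrite ler_wpM2l.
  have h2 : q * q ^+ n * (1 - q) <= 1 - q.
    by rewrite -exprS ler_piMl ?subr_ge0 ?(ltW q1) // exprn_ile1 // ltW.
  by move: h h2; set a := q ^+ n; set b := n%:R; nra.
have bnd n : n.+1%:R * s ^+ n <= ((1 - q)^-1 + 1) * q ^+ n.
  have qn0 : 0 <= q ^+ n by rewrite exprn_ge0.
  rewrite -qs exprAC expr2 mulrA ler_wpM2r // -natr1 mulrDl mul1r lerD //.
    rewrite -[leRHS]mul1r ler_pdivlMr ?subr_gt0 // (le_trans (qn n)) //.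
    by rewrite lerBlDr lerDl.
  by rewrite exprn_ile1 // ltW.
apply: (@squeeze_cvgr _ _ _ _ (cst 0) (fun n => ((1 - q)^-1 + 1) * q ^+ n)).
- by apply: nearW => n; rewrite bnd andbT mulr_ge0 // exprn_ge0.
- exact: cvg_cst.
- have -> : (0 : R) = ((1 - q)^-1 + 1) * 0 by rewrite mulr0.
  by apply: cvgMl_tmp; apply: cvg_expr; rewrite ger0_norm.
Qed.

(** Substituting [u = 1 - t / M] in the series brings [t] in [[m, M]] to [u] in [[0, 1 - m / M]],
    away from the singularity at [u = 1]. *)
Definition binpoly r M n : {poly R[i]} :=
  (M `^ r)%:C *: \sum_(k < n) (binc r k)%:C *: (1 - (M^-1)%:C *: 'X) ^+ k.

Lemma binpoly_horner r M n t :
  (binpoly r M n).[t%:C] = (M `^ r * binser r n (1 - t / M))%:C.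
Proof.
rewrite /binpoly hornerZ horner_sum rmorphM rmorph_sum /=; congr (_ * _).
apply: eq_bigr => k _; rewrite !hornerE rmorphM rmorphXn rmorphB rmorphM /=.
by rewrite [_^-1%:C * _]mulrC.
Qed.

Lemma binpoly_cvg r m M : -1 <= r <= 1 -> 0 < m -> m <= M ->
  forall e, 0 < e -> \forall n \near \oo, forall t, m <= t <= M ->
    `|M `^ r * binser r n (1 - t / M) - t `^ r| <= e.
Proof.
move=> r1 m0 mM e e0; have M0 : 0 < M by exact: lt_le_trans mM.
pose d := m / M; have d0 : 0 < d by rewrite divr_gt0.
have d1 : d <= 1 by rewrite ler_pdivrMr // mul1r.
pose K := M `^ r * d^-1 ^+ 3.
have K0 : 0 < K by rewrite mulr_gt0 ?powR_gt0 // exprn_gt0 // invr_gt0.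
have eK : 0 < e / K by rewrite divr_gt0.
have /cvgrPdist_le/(_ _ eK)[N _ hN] := @cvg_nat_geometric (1 - d) ltac:(lra) ltac:(lra).
(* The shift is there because [binser_err] estimates the sum of [n.+1] terms. *)
exists N.+1 => // -[//|n] /= Nn t /andP[mt tM].
have t0 : 0 < t by lra.
have tr : t `^ r = M `^ r * (1 - (1 - t / M)) `^ r.
  by rewrite subKr -powRM ?(ltW M0) ?divr_ge0 ?(ltW M0) ?(ltW t0) // mulrC divfK ?gt_eqF.
rewrite tr -mulrBr normrM (ger0_norm (powR_ge0 _ _)).
have h : `|binser r n.+1 (1 - t / M) - (1 - (1 - t / M)) `^ r| <=
    d^-1 ^+ 3 * (n.+1%:R * (1 - d) ^+ n).
  apply: binser_err => //; first by rewrite subr_ge0 ler_pdivrMr // mul1r.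
  by rewrite lerD2l lerN2 ler_pM2r ?invr_gt0.
rewrite (le_trans (ler_wpM2l (powR_ge0 _ _) h)) // mulrA -/K mulrC -ler_pdivlMr //.
have := hN n Nn; rewrite /= sub0r normrN ger0_norm // mulr_ge0 // exprn_ge0 //; lra.
Qed.

End binomial_series.

(** * Functional calculus *)

Section functional_calculus.
Variables (R : realType) (H : hilbertType R).
Implicit Types (S T Z : bop H) (p : nat -> {poly R[i]}) (f : R[i] -> R[i]).

Definition spectrum_cvg T f p := forall e : R, 0 < e ->
  \forall n \near \oo, forall z, spectrum T z -> `|(p n).[z] - f z| <= e%:C.

(** Closeness on the spectrum becomes closeness in norm. With [q = p] this yields a Cauchy sequence,
    in general the independence of the limit. *)
Lemma spectrum_cvg_dist T f p q : selfadjoint T ->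
  spectrum_cvg T f p -> spectrum_cvg T f q ->
  forall e : R, 0 < e -> exists N, forall n k, (N <= n)%N -> (N <= k)%N ->
    opnorm (op_horner (p n) T - op_horner (q k) T) <= e.
Proof.
move=> sT pf qf e e0; have e20 : 0 < e / 2 by rewrite divr_gt0.
have [N1 _ h1] := pf _ e20; have [N2 _ h2] := qf _ e20.
exists (maxn N1 N2) => n k; rewrite !geq_max => /andP[n1 _] /andP[_ k2].
rewrite -op_hornerB; apply: op_horner_spectrum_bound => //; first exact: ltW.
move=> z zT; rewrite hornerD hornerN -(subrK (f z) (p n).[z]) -addrA.
rewrite (le_trans (ler_normD _ _)) // [e in e%:C]splitr rmorphD lerD ?h1 //.
by rewrite distrC h2.
Qed.

(** [fcalc] picks a limit along some sequence [q]; [spectrum_cvg_dist] transfers it to the given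
    [p]. *)
Lemma fcalc_cvg T f p : selfadjoint T -> spectrum_cvg T f p ->
  opcvg (fun n => op_horner (p n) T) (fcalc T f).
Proof.
move=> sT pf.
have [S0 pS0] : exists S, opcvg (fun n => op_horner (p n) T) S.
  by apply: opcauchy_cvg; exact: (spectrum_cvg_dist sT pf pf).
(* The limit [S0] shows that the default value 0 of [xget] is not taken for want of candidates. *)
have [q [qf qS]] : is_fcalc T f (fcalc T f).
  by apply: (@xgetPex _ 0 [set S | is_fcalc T f S]); exists S0, p.
rewrite -[fcalc T f](addr0) /opcvg.
have pq : opcvg (fun n => op_horner (p n) T - op_horner (q n) T) 0.
  apply/cvgrPdist_le => e e0; have [N hN] := spectrum_cvg_dist sT pf qf e0.
  exists N => // n Nn; rewrite /= subr0 sub0r normrN ger0_norm ?opnorm_ge0 //.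
  exact: hN.
have := opcvgD qS pq; rewrite /opcvg; under eq_fun do rewrite [_ + (_ - _)]addrC subrK.
exact.
Qed.

End functional_calculus.

(** * Real powers of an operator between two positive constants *)

Section real_powers.
Variables (R : realType) (H : hilbertType R) (T : bop H) (m M : R).
Hypotheses (sT : selfadjoint T) (m0 : 0 < m) (mM : m <= M).
Hypothesis Tm : forall x, m * nrm x ^+ 2 <= rip (T x) x.
Hypothesis TM : forall x, rip (T x) x <= M * nrm x ^+ 2.
Implicit Types (r s : R) (Z : bop H) (n : nat).

Lemma op_horner_itv_bound (p : {poly R[i]}) (e : R) : 0 <= e ->
  (forall t, m <= t <= M -> `|p.[t%:C]| <= e%:C) -> opnorm (op_horner p T) <= e.
Proof.
move=> e0 pe; apply: op_horner_spectrum_bound => // z.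
by move=> /(spectrum_itv sT Tm TM)[t -> tmM]; exact: pe.
Qed.

Lemma spectrum_cvg_binpoly r : -1 <= r <= 1 ->
  spectrum_cvg T (fun z => (complex.Re z `^ r)%:C) (binpoly r M).
Proof.
move=> r1 e e0; have := binpoly_cvg r1 m0 mM e0.
apply: filterS => n hn z /(spectrum_itv sT Tm TM)[t -> tmM].
by rewrite binpoly_horner -rmorphB /= cabsE cabsR lecR hn.
Qed.

Lemma op_powR_cvg r : -1 <= r <= 1 ->
  opcvg (fun n => op_horner (binpoly r M n) T) (op_powR T r).
Proof. by move=> r1; apply: fcalc_cvg => //; exact: spectrum_cvg_binpoly. Qed.

Lemma op_powR_poly r (h : {poly R[i]}) :
  (forall t, m <= t <= M -> h.[t%:C] = (t `^ r)%:C) -> op_powR T r = op_horner h T.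
Proof.
move=> hr; apply: (opcvg_uniq _ (opcvg_cst _)).
apply: (@fcalc_cvg _ _ _ _ (fun=> h)) => // e e0.
apply: nearW => n z /(spectrum_itv sT Tm TM)[t -> tmM].
by rewrite hr // subrr normr0 ler0c ltW.
Qed.

Lemma powR_itv_le r t : -1 <= r <= 1 -> m <= t <= M -> t `^ r <= M + m^-1.
Proof.
move=> /andP[rl rr] /andP[mt tM]; have t0 : 0 < t by exact: lt_le_trans mt.
have M0 : 0 < M by exact: lt_le_trans mM.
have [t1|t1] := leP 1 t.
  rewrite (le_trans (ler_powR t1 rr)) // powRr1 ?(ltW t0) //.
  by rewrite (le_trans tM) // lerDl invr_ge0 ltW.
have t01 : 0 < t <= 1 by rewrite t0 ltW.
rewrite (le_trans (ger_powR t01 rl)) // powR_inv1 ?(ltW t0) //.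
by rewrite (@le_trans _ _ m^-1) ?lerDr ?(ltW M0) // lef_pV2 ?posrE.
Qed.

(** Products of the approximating polynomials converge uniformly to the product of the powers. The
    case of a polynomial product covers the square root and its inverse. *)
Lemma op_powRM r s (h : {poly R[i]}) : -1 <= r <= 1 -> -1 <= s <= 1 ->
  (forall t, m <= t <= M -> h.[t%:C] = (t `^ r * t `^ s)%:C) ->
  op_powR T r * op_powR T s = op_horner h T.
Proof.
move=> r1 s1 hrs; apply: opcvg_uniq (opcvgM (op_powR_cvg r1) (op_powR_cvg s1)) _.
pose K := M + m^-1.
have K0 : 0 <= K by rewrite addr_ge0 ?invr_ge0 ?(ltW m0) // (le_trans (ltW m0)).
(* Errors at most [d] in both factors cost [d * d + d * K + K * d], which is at most
   [d * (1 + 2 * K)] since [d <= 1]. *)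
apply/cvgrPdist_le => e e0; pose d := Num.min 1 (e / (1 + 2 * K)).
have K10 : 0 < 1 + 2 * K by rewrite ltr_pwDl // mulr_ge0.
have d0 : 0 < d by rewrite lt_min ltr01 divr_gt0.
have d1 : d <= 1 by rewrite ge_min lexx.
have de : d * (1 + 2 * K) <= e by rewrite -ler_pdivlMr // ge_min lexx orbT.
near=> n; rewrite /= sub0r normrN ger0_norm ?opnorm_ge0 //.
rewrite -op_hornerM -op_hornerB; apply: op_horner_itv_bound; first exact: ltW.
move=> t tmM; rewrite hornerD hornerN hrs // hornerM !binpoly_horner.
rewrite -rmorphM -rmorphB /= cabsE cabsR lecR.
have : forall t, m <= t <= M -> `|M `^ r * binser r n (1 - t / M) - t `^ r| <= d.
  by near: n; exact: binpoly_cvg.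
have : forall t, m <= t <= M -> `|M `^ s * binser s n (1 - t / M) - t `^ s| <= d.
  by near: n; exact: binpoly_cvg.
move=> /(_ t tmM) + /(_ t tmM).
have := powR_itv_le r1 tmM; have := powR_itv_le s1 tmM; rewrite -/K.
have := powR_ge0 t r; have := powR_ge0 t s.
set a := t `^ r; set b := t `^ s; set x := _ * _; set y := _ * _.
move=> b0 a0 bK aK yb xa.
have -> : y * x - a * b = (y - a) * (x - b) + (y - a) * b + a * (x - b) by ring.
rewrite (le_trans _ de) // (le_trans (ler_normD _ _)) //.
rewrite (_ : d * (1 + 2 * K) = d * 1 + d * K + K * d); last by ring.
rewrite lerD //.
  rewrite (le_trans (ler_normD _ _)) // lerD // normrM ler_pM //.
    by rewrite (le_trans yb).
  by rewrite ger0_norm.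
by rewrite normrM ler_pM // ger0_norm.
Unshelve. all: by end_near. Qed.

Lemma op_horner_binpoly r n Z : op_horner (binpoly r M n) Z =
  (M `^ r)%:C *: \sum_(k < n) (binc r k)%:C *: (1 - (M^-1)%:C *: Z) ^+ k.
Proof.
rewrite /binpoly op_hornerZ op_horner_sum; congr (_ *: _).
apply: eq_bigr => k _; rewrite op_hornerZ op_hornerXn op_hornerB op_hornerZ.
by rewrite op_hornerX -[X in op_horner X]/(1%:P) op_hornerC scale1r.
Qed.

Lemma selfadjointX Z n : selfadjoint Z -> selfadjoint (Z ^+ n).
Proof.
move=> sZ; elim: n => [|n IH]; first by rewrite expr0; exact: selfadjoint1.
by rewrite exprS; apply: selfadjointM => //; rewrite -exprS -exprSr.
Qed.

Lemma op_powR_selfadjoint r : -1 <= r <= 1 -> selfadjoint (op_powR T r).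
Proof.
move=> r1; apply: opcvg_selfadjoint (op_powR_cvg r1) => n.
rewrite op_horner_binpoly; apply: selfadjointZ.
elim/big_ind: _ => [|X Y sX sY|k _]; first exact: selfadjoint0.
  exact: selfadjointD.
apply: selfadjointZ; apply: selfadjointX; apply: selfadjointB; first exact: selfadjoint1.
exact: selfadjointZ.
Qed.

Lemma op_powR_comm r Z : -1 <= r <= 1 -> GRing.comm Z T -> GRing.comm Z (op_powR T r).
Proof.
move=> r1 ZT; apply: opcvg_comm (op_powR_cvg r1) => n.
exact: op_horner_comm.
Qed.

Lemma op_powR_half : op_powR T 2^-1 * op_powR T 2^-1 = T.
Proof.
rewrite (@op_powRM _ _ 'X) ?op_hornerX //; try (by apply/andP; split; lra).
move=> t /andP[mt _]; have t0 : 0 < t by exact: lt_le_trans mt.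
rewrite hornerX -powRD ?(gt_eqF t0) ?implybT //.
by rewrite (_ : 2^-1 + 2^-1 = 1) ?powRr1 ?(ltW t0) //; lra.
Qed.

Lemma op_powR_halfV : op_powR T 2^-1 * op_powR T (- 2^-1) = 1.
Proof.
rewrite (@op_powRM _ _ 1%:P) ?op_hornerC ?scale1r //; try (by apply/andP; split; lra).
move=> t /andP[mt _]; have t0 : 0 < t by exact: lt_le_trans mt.
by rewrite hornerC -powRD ?(gt_eqF t0) ?implybT // subrr powRr0.
Qed.

End real_powers.

(** * Commuting positive operators *)

Section commuting_positive.
Variables (R : realType) (H : hilbertType R).
Implicit Types (A B S T U V W Z : bop H) (n k : nat) (c l m e : R).

Local Notation Id := (1 : bop H).

(** If [W] has a square root [Q] commuting with [Z], then [W Z = Q Z Q >= 0]. As [W] need not be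
    bounded below, this is done for [W + e], and [e] is made small. *)
Lemma op_ge0M W Z : op_ge0 W -> op_ge0 Z -> GRing.comm W Z -> op_ge0 (W * Z).
Proof.
move=> W0 Z0 WZ; have [/op_ge0P[sW W1] /op_ge0P[sZ Z1]] := (W0, Z0).
apply/op_ge0P; split; first exact: selfadjointM.
have We e : 0 < e -> op_ge0 ((W + e%:C *: Id) * Z).
  move=> e0; set X := W + _.
  have sX : selfadjoint X by apply: selfadjointD => //; apply: selfadjointZ; exact: selfadjoint1.
  have Xx x : rip (X x) x = rip (W x) x + e * nrm x ^+ 2.
    by rewrite /X !bopE ripDl ripZl ripxx.
  have eX : e <= opnorm W + e by rewrite lerDr opnorm_ge0.
  have Xe x : e * nrm x ^+ 2 <= rip (X x) x by rewrite Xx lerDr W1.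
  have XM x : rip (X x) x <= (opnorm W + e) * nrm x ^+ 2.
    by rewrite Xx mulrDl lerD2r rip_opnorm.
  have h1 : -1 <= (2^-1 : R) <= 1 by apply/andP; split; lra.
  have ZX : GRing.comm Z X.
    rewrite /GRing.comm /X mulrDr mulrDl WZ; congr (_ + _).
    by rewrite -bop_scalerAr -bop_scalerAl mulr1 mul1r.
  have ZQ := op_powR_comm sX e0 eX Xe XM h1 ZX.
  rewrite -(op_powR_half sX e0 eX Xe XM) -mulrA -ZQ mulrA.
  apply: op_ge0_conj => //; exact: (op_powR_selfadjoint sX e0 eX Xe XM h1).
move=> x; rewrite leNgt; apply/negP => WZx.
(* Small enough that adding [e * rip (Z x) x] leaves the form negative; the 1 makes this strict. *)
pose e := - rip ((W * Z) x) x / (rip (Z x) x + 1).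
have e0 : 0 < e by rewrite divr_gt0 ?oppr_gt0 // ltr_wpDl.
have [_ /(_ x)] := (op_ge0P _).1 (We e e0).
rewrite bopME bopDE ripDl bopZE bop1E ripZl -bopME leNgt => /negP; apply.
rewrite -ltrBrDl sub0r /e -mulrAC ltr_pdivrMr ?ltr_wpDl // ltr_pM2l ?oppr_gt0 //.
by rewrite ltrDl.
Qed.

Lemma op_ge0X U n : op_ge0 U -> op_ge0 (U ^+ n).
Proof.
move=> U0; elim: n => [|n IH]; first by rewrite expr0; exact: op_ge01.
by rewrite exprS; apply: op_ge0M => //; exact: commrX.
Qed.

(** Induction through [U^(n+1) - V^(n+1) = U (U^n - V^n) + V^n (U - V)]; the last term times [U - V]
    is a positive operator times a square. *)
Lemma op_ge0_Chebyshev U V n : op_ge0 U -> op_ge0 V -> GRing.comm U V ->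
  op_ge0 ((U ^+ n - V ^+ n) * (U - V)).
Proof.
move=> U0 V0 UV; have UVn k : GRing.comm U (V ^+ k) by exact: commrX.
elim: n => [|n IH]; first by rewrite !expr0 subrr mul0r; exact: op_ge00.
have UB : GRing.comm U (U - V) by apply: commrB.
have UBn : GRing.comm U (U ^+ n - V ^+ n) by apply: commrB; [exact: commrX|].
have VB : GRing.comm (V ^+ n) (U - V).
  by apply: commrB; [exact: commr_sym|apply: commr_sym; exact: commrX].
have -> : (U ^+ n.+1 - V ^+ n.+1) * (U - V) =
    U * ((U ^+ n - V ^+ n) * (U - V)) + V ^+ n * ((U - V) * (U - V)).
  rewrite mulrA [V ^+ n * _]mulrA -mulrDl; congr (_ * _).
  by rewrite mulrBr -exprS mulrBr -UVn addrA subrK -exprSr.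
apply: op_ge0D; apply: op_ge0M => //.
- exact: commrM.
- exact: op_ge0X.
- by apply: op_ge0_sqr; apply: selfadjointB; [exact: U0.1|exact: V0.1].
- exact: commrM.
Qed.

(* Jensen's inequality for [t ^ n]: [V] is the mean of [U] and [W] with the
   weights [A] and [S]. *)
Lemma op_ge0_Jensen A S U W V n :
  op_ge0 A -> op_ge0 S -> op_ge0 U -> op_ge0 W -> op_ge0 V ->
  GRing.comm A U -> GRing.comm A V -> GRing.comm S W -> GRing.comm S V ->
  GRing.comm U V -> GRing.comm W V -> (A + S) * V = A * U + S * W ->
  GRing.comm A S -> GRing.comm S U -> GRing.comm A W -> GRing.comm U W ->
  op_ge0 (A * U ^+ n + S * W ^+ n - (A + S) * V ^+ n).
Proof.
move=> A0 S0 U0 W0 V0 AU AV SW SV UV WV ASV AS SU AW UW.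
elim: n => [|n IH].
  by rewrite !expr0 !mulr1 subrr; exact: op_ge00.
have VU := commr_sym UV; have VW := commr_sym WV.
have VA := commr_sym AV; have VS := commr_sym SV.
(* On expansion, the leftover [V^n (A (U - V) + S (W - V))] vanishes because [V] is the mean. *)
have -> : A * U ^+ n.+1 + S * W ^+ n.+1 - (A + S) * V ^+ n.+1 =
    V * (A * U ^+ n + S * W ^+ n - (A + S) * V ^+ n) +
    (A * ((U ^+ n - V ^+ n) * (U - V)) + S * ((W ^+ n - V ^+ n) * (W - V))).
  have eq1 (X Z : bop H) : GRing.comm V X -> GRing.comm V Z ->
      X * ((Z ^+ n - V ^+ n) * (Z - V)) =
      (X * Z ^+ n.+1 - V * (X * Z ^+ n)) - (V ^+ n * (X * Z) - V ^+ n * (X * V)).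
    move=> VX VZ; have XVn : GRing.comm X (V ^+ n).
      by apply: commrX; exact: commr_sym.
    have VXZ : GRing.comm V (X * Z ^+ n) by apply: commrM => //; exact: commrX.
    by rewrite mulrBl !mulrBr -exprSr VXZ !mulrA -XVn.
  have VAS : GRing.comm V (A + S) by exact: commrD.
  rewrite !eq1 // addrACA -opprD [X in _ = _ + (_ - X)]addrACA -opprD.
  rewrite -!(mulrDr (V ^+ n)) -ASV -mulrDl subrr subr0 [X in _ = _ + X]addrACA -opprD.
  by rewrite [RHS]addrC mulrBr mulrDr [RHS]addrA subrK [V * (_ * _ ^+ n)]mulrA VAS -mulrA -exprS.
apply: op_ge0D.
  apply: op_ge0M => //; apply: commrB; last first.
    apply: commrM; last exact: commrX.
    exact: commrD.
  by apply: commrD; apply: commrM => //; exact: commrX.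
apply: op_ge0D; apply: op_ge0M => //.
- exact: op_ge0_Chebyshev.
- by apply: commrM; apply: commrB => //; exact: commrX.
- exact: op_ge0_Chebyshev.
- by apply: commrM; apply: commrB => //; exact: commrX.
Qed.

End commuting_positive.

(** * Geometric means of commuting operators *)

Section geometric_mean.
Variables (R : realType) (H : hilbertType R).
Implicit Types (A B S T U V W Z : bop H) (n k : nat) (l m M : R).

Local Notation Id := (1 : bop H).

Lemma rip_opnorm_le T M x : opnorm T <= M -> rip (T x) x <= M * nrm x ^+ 2.
Proof.
by move=> TM; apply: le_trans (rip_opnorm T x) _; rewrite ler_wpM2r ?sqr_ge0.
Qed.

(** Invertibility gives [c |x| <= |A x|], and positivity gives
    [|A x|^2 <= (opnorm A + 1) <A x, x>]. *)
Lemma op_gt0_lower_bound A : op_gt0 A -> op_invertible A ->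
  exists2 m : R, 0 < m & forall x, m * nrm x ^+ 2 <= rip (A x) x.
Proof.
move=> [sA A0] /op_invertible_below[c c0 Ac].
have A_ge0 : op_ge0 A.
  split=> // x; have [->|/A0/ltW//] := eqVneq x 0.
  by rewrite linear0r.
have K0 : 0 < opnorm A + 1 by rewrite ltr_wpDl ?opnorm_ge0.
have AK y : rip (A y) y <= (opnorm A + 1) * nrm y ^+ 2.
  by apply: rip_opnorm_le; rewrite lerDl.
exists ((opnorm A + 1)^-1 * c ^+ 2) => [|x].
  by rewrite mulr_gt0 ?invr_gt0 ?exprn_gt0.
rewrite -mulrA ler_pdivrMl // (le_trans _ (op_ge0_sqr_le x A_ge0 K0 AK)) //.
by rewrite -exprMn ler_sqr ?nnegrE ?mulr_ge0 ?nrm_ge0 ?(ltW c0).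
Qed.

(** [T = A^(-1/2) B A^(-1/2)] plays the role of [A^-1 B]. Its power commutes with [A^(1/2)], so the
    two outer square roots merge into [A]. *)
Lemma geom_mean_commE l A B m : -1 <= l <= 1 ->
  selfadjoint A -> selfadjoint B -> GRing.comm A B -> 0 < m ->
  (forall x, m * nrm x ^+ 2 <= rip (A x) x) -> op_le A B ->
  exists T, [/\ selfadjoint T, forall x, 1 * nrm x ^+ 2 <= rip (T x) x,
    A * T = B, forall Z, GRing.comm Z A -> GRing.comm Z B -> GRing.comm Z T &
    geom_mean l A B = A * op_powR T l].
Proof.
move=> l1 sA sB AB m0 mA /op_ge0P[_ BA].
have mM : m <= m + opnorm A by rewrite lerDl opnorm_ge0.
have AM x : rip (A x) x <= (m + opnorm A) * nrm x ^+ 2.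
  by apply: rip_opnorm_le; rewrite lerDr ltW.
have h1 : -1 <= (2^-1 : R) <= 1 by apply/andP; split; lra.
have h2 : -1 <= (- 2^-1 : R) <= 1 by apply/andP; split; lra.
have QQ := op_powR_half sA m0 mM mA AM; have QN := op_powR_halfV sA m0 mM mA AM.
have Qc Z := @op_powR_comm _ _ A _ _ sA m0 mM mA AM _ Z h1.
have Nc Z := @op_powR_comm _ _ A _ _ sA m0 mM mA AM _ Z h2.
have sN := op_powR_selfadjoint sA m0 mM mA AM h2.
rewrite /geom_mean; set Q := op_powR A 2^-1 in QQ QN Qc *.
set N := op_powR A (- 2^-1) in QN Nc sN *; clearbody Q N.
have QA : GRing.comm Q A by rewrite /GRing.comm -QQ mulrA.
have NA : GRing.comm N A := commr_sym (Nc _ (commr_refl A)).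
have QcN : GRing.comm Q N by exact: Nc.
have BN : GRing.comm B N by apply: Nc; exact: commr_sym.
have BQ : GRing.comm B Q by apply: Qc; exact: commr_sym.
have NAN : N * A * N = 1.
  by rewrite -QQ mulrA -QcN QN mul1r QN.
have [T TE] : {T | T = N * B * N} by exists (N * B * N).
have sT : selfadjoint T.
  apply/selfadjointP => x y; rewrite TE !bopME (selfadjointP N).1 //.
  by rewrite (selfadjointP B).1 // (selfadjointP N).1.
(* [A <= B] is applied at [N x], and [N * A * N = 1]. *)
have T1 x : 1 * nrm x ^+ 2 <= rip (T x) x.
  rewrite mul1r -ripxx -{1}(bop1E x) -NAN TE !bopME.
  rewrite !((selfadjointP N).1 sN _ x) -subr_ge0 -ripBl.
  exact: BA.
have Tc Z : GRing.comm Z A -> GRing.comm Z B -> GRing.comm Z T.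
  by move=> ZA ZB; rewrite TE; exact: (commrM (commrM (Nc _ ZA) ZB) (Nc _ ZA)).
exists T; split; [exact: sT|exact: T1| |exact: Tc|].
  by rewrite TE !mulrA -NA -mulrA BN mulrA NAN mul1r.
have TM x : rip (T x) x <= (1 + opnorm T) * nrm x ^+ 2.
  by apply: rip_opnorm_le; rewrite lerDr.
have mT : 1 <= 1 + opnorm T by rewrite lerDl opnorm_ge0.
have QT := op_powR_comm sT ltr01 mT T1 TM l1 (Tc Q QA (commr_sym BQ)).
by rewrite -TE; move: (op_powR T l) QT => G QT; rewrite -mulrA -QT mulrA QQ.
Qed.

Lemma comm_1BZ (c : R[i]) Z T : GRing.comm Z T -> GRing.comm Z (1 - c *: T).
Proof.
move=> ZT; apply: commrB; first exact: commr1.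
by rewrite /GRing.comm -bop_scalerAr -bop_scalerAl ZT.
Qed.

Lemma op_ge0_1BZ M T : selfadjoint T -> 0 < M ->
  (forall x, rip (T x) x <= M * nrm x ^+ 2) -> op_ge0 (1 - (M^-1)%:C *: T).
Proof.
move=> sT M0 TM; apply/op_ge0P; split.
  by apply: selfadjointB; [exact: selfadjoint1|exact: selfadjointZ].
by move=> x; rewrite !bopE ripBl ripZl ripxx subr_ge0 ler_pdivrMl.
Qed.

(* With [T = A^-1 B] and [T' = (A + S)^-1 (B + S)], this is the superadditivity
   of the weighted geometric mean, in the case where one summand is the mean of
   [S] with itself. *)
Lemma op_le_powR_add A B S T T' l : 0 <= l <= 1 ->
  op_ge0 A -> op_ge0 S -> selfadjoint T -> selfadjoint T' ->
  (forall x, 1 * nrm x ^+ 2 <= rip (T x) x) ->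
  (forall x, 1 * nrm x ^+ 2 <= rip (T' x) x) ->
  A * T = B -> (A + S) * T' = B + S ->
  GRing.comm A S -> GRing.comm A T -> GRing.comm A T' -> GRing.comm S T ->
  GRing.comm S T' -> GRing.comm T T' ->
  op_le (A * op_powR T l + S) ((A + S) * op_powR T' l).
Proof.
move=> l01 A0 S0 sT sT' T1 T1' AT ST' cAS cAT cAT' cST cST' cTT'.
have l1 : -1 <= l <= 1 by case/andP: l01 => l0 l1; apply/andP; split; lra.
(* A common upper bound for [T], [T'] and the identity, so that a single scale serves all three
   series. *)
pose M := 1 + opnorm T + opnorm T'.
have M1 : 1 <= M by rewrite /M -addrA lerDl addr_ge0 ?opnorm_ge0.
have M0 : 0 < M by exact: lt_le_trans M1.
have TM x : rip (T x) x <= M * nrm x ^+ 2.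
  by apply: rip_opnorm_le; rewrite /M; have := opnorm_ge0 T'; lra.
have TM' x : rip (T' x) x <= M * nrm x ^+ 2.
  by apply: rip_opnorm_le; rewrite /M; have := opnorm_ge0 T; lra.
have I1 (x : H) : 1 * nrm x ^+ 2 <= rip (Id x) x by rewrite mul1r ripxx.
have IM (x : H) : rip (Id x) x <= M * nrm x ^+ 2.
  by rewrite ripxx ler_peMl ?sqr_ge0.
have II (x : H) : rip (Id x) x <= 1 * nrm x ^+ 2 by rewrite mul1r ripxx.
have s1 : selfadjoint Id by exact: selfadjoint1.
have Id_l : op_powR Id l = 1.
  rewrite (@op_powR_poly _ _ Id 1 1 s1 I1 II l 1%:P) ?op_hornerC ?scale1r //.
  by move=> t t1; rewrite -(le_anti t1) hornerC powR1.
have cT := op_powR_cvg sT ltr01 M1 T1 TM l1.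
have cT' := op_powR_cvg sT' ltr01 M1 T1' TM' l1.
(* Expanding 1 as a power of the identity turns [S] into a series as well, and the comparison
   becomes termwise. *)
have cI := op_powR_cvg s1 ltr01 M1 I1 IM l1; rewrite Id_l in cI.
have := opcvgB (opcvgM (opcvg_cst (A + S)) cT')
  (opcvgD (opcvgM (opcvg_cst A) cT) (opcvgM (opcvg_cst S) cI)).
rewrite mulr1; apply: opcvg_ge0 => n; rewrite !op_horner_binpoly.
set U := 1 - _ *: T; set V := 1 - _ *: T'; set W := 1 - _ *: Id.
have -> : (A + S) * ((M `^ l)%:C *: \sum_(k < n) (binc l k)%:C *: V ^+ k) -
    (A * ((M `^ l)%:C *: \sum_(k < n) (binc l k)%:C *: U ^+ k) +
     S * ((M `^ l)%:C *: \sum_(k < n) (binc l k)%:C *: W ^+ k)) =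
    (M `^ l)%:C *: \sum_(k < n) (- binc l k)%:C *:
      (A * U ^+ k + S * W ^+ k - (A + S) * V ^+ k).
  rewrite -!bop_scalerAr -scalerDr -scalerBr; congr (_ *: _).
  rewrite !mulr_sumr -big_split -sumrB; apply: eq_bigr => k _ /=.
  by rewrite -!bop_scalerAr -scalerDr -scalerBr rmorphN scaleNr -scalerN opprB.
apply: op_ge0Z; first exact: powR_ge0.
elim/big_ind: _ => [|X Y|[[|k] _] _ /=]; first exact: op_ge00.
- exact: op_ge0D.
(* The term [k = 0], whose coefficient has the wrong sign, vanishes identically. *)
- by rewrite !expr0 !mulr1 subrr scaler0; exact: op_ge00.
apply: op_ge0Z; first by rewrite oppr_ge0 binc_le0.
have comm1 Z : GRing.comm Z Id by exact: commr1.
apply: op_ge0_Jensen => //; rewrite ?/U ?/V ?/W; try exact: op_ge0_1BZ.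
all: try (by apply: comm_1BZ).
- by apply: comm_1BZ; apply: commr_sym; apply: comm_1BZ; exact: commr_sym.
- by apply: comm_1BZ; apply: commr_sym; apply: comm_1BZ; exact: commr1.
(* Both sides of the mean relation equal [(A + S) - M^-1 (B + S)]. *)
- by rewrite !mulrBr -!bop_scalerAr !mulr1 AT ST' addrACA -opprD -scalerDr.
Qed.

End geometric_mean.

(** * The inequality for complementary operators *)

Theorem theorem2p3 (R : realType) (H : hilbertType R) (A B : bop H)
    (l : R) (hAB : A * B = B * A)
    (hA : selfadjoint A) (hB : selfadjoint B)
    (hAinv : op_invertible A) (hBinv : op_invertible B)
    (hA0 : op_gt0 A) (hAleB : op_le A B) (hB2 : op_le B (2^-1 *: (1 : bop H)))
    (hl0 : 0 < l) (hl2 : l <= 2^-1) :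
  let A' := 1 - A in
  let B' := 1 - B in
  op_le (arith_mean l B' A' - geom_mean l B' A')
        (arith_mean l A B - geom_mean l A B).
Proof.
move=> A' B'; pose S : bop H := 1 - A - B.
have AS : A + S = B' by rewrite /S addrA [A + _]addrC subrK.
have BS : B + S = A' by rewrite /S addrC subrK.
have h2 : (2^-1 : R[i]) = (2^-1 : R)%:C by rewrite fmorphV rmorph_nat.
have [m m0 mA] := op_gt0_lower_bound hA0 hAinv.
have l1 : -1 <= l <= 1 by apply/andP; split; lra.
have [T [sT T1 AT Tc ->]] := geom_mean_commE l1 hA hB hAB m0 mA hAleB.
have sB' : selfadjoint B' by apply: selfadjointB => //; exact: selfadjoint1.
have sA' : selfadjoint A' by apply: selfadjointB => //; exact: selfadjoint1.
have cB'A' : GRing.comm B' A'.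
  by apply: commrB; [exact: commr1|apply: commr_sym; apply: commrB; [exact: commr1|]].
have BA' : op_le B' A' by rewrite /op_le /A' /B' opprB addrC addrA subrK.
have B2 x : rip (B x) x <= 2^-1 * nrm x ^+ 2.
  have /op_ge0P[_ /(_ x)] := hB2; rewrite h2 !bopE ripBl ripZl ripxx subr_ge0.
  exact.
(* [B <= 1/2] supplies the positive lower bound needed to form the powers of [B']. *)
have mB' x : 2^-1 * nrm x ^+ 2 <= rip (B' x) x.
  by rewrite /B' !bopE ripBl ripxx; have := B2 x; lra.
have [T' [sT' T1' BT' Tc' ->]] :=
  geom_mean_commE l1 sB' sA' cB'A' (ltac:(lra) : 0 < 2^-1 :> R) mB' BA'.
have A_ge0 : op_ge0 A.
  apply/op_ge0P; split=> // x; apply: le_trans (mA x).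
  by rewrite mulr_ge0 ?sqr_ge0 // ltW.
(* Both [A] and [B] are at most one half, so their sum is at most 1. *)
have S_ge0 : op_ge0 S.
  apply/op_ge0P; split; first by apply: selfadjointB => //; exact: sA'.
  move=> x; have /op_ge0P[_ /(_ x)] := hAleB; have := B2 x.
  by rewrite /S !bopE !ripBl ripxx; lra.
have c1 (X Y : bop H) : GRing.comm X Y -> GRing.comm X (1 - Y).
  by move=> XY; apply: commrB => //; exact: commr1.
have cS (Z : bop H) : GRing.comm Z A -> GRing.comm Z B -> GRing.comm Z S.
  by move=> ZA ZB; apply: commrB => //; exact: c1.
have cAT' (Z : bop H) : GRing.comm Z A -> GRing.comm Z B -> GRing.comm Z T'.
  by move=> ZA ZB; apply: Tc'; exact: c1.
have BA : GRing.comm B A by exact: esym.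
have SA : GRing.comm S A by apply: commr_sym; exact: cS.
have SB : GRing.comm S B by apply: commr_sym; exact: cS.
have TA : GRing.comm T A by apply: commr_sym; exact: Tc.
have TB : GRing.comm T B by apply: commr_sym; exact: Tc.
rewrite -AS -BS in BT'.
have := @op_le_powR_add _ _ A B S T T' l _ A_ge0 S_ge0 sT sT' T1 T1' AT BT'.
rewrite AS => /(_ ltac:(apply/andP; split; lra)) h.
have {h} : op_le (A * op_powR T l + S) (B' * op_powR T' l).
  by apply: h; [exact: cS|exact: Tc|exact: cAT'|exact: Tc|exact: cAT'|exact: cAT'].
rewrite /op_le; congr op_ge0.
clearbody S.
(* The weights sum to 1, so adding [S] to both arguments adds [S] to the mean; this is the [S] of
   the estimate just obtained. *)
have -> : arith_mean l B' A' = arith_mean l A B + S.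
  rewrite /arith_mean -AS -BS !scalerDr addrACA -scalerDl -rmorphD subrK.
  by rewrite scale1r.
move: (arith_mean l A B) (A * _) (B' * _) => D X Y.
by rewrite opprB [RHS]addrC !opprD [- D - S]addrC !addrA subrK addrAC.
Qed.
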